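(* Let $k$ be an infinite field, let $n\ge 3$ and $m\ge 2$ be integers with $m(m-1)\ge n$, and let $\mathcal{L}$ be an $m\times(m-1)$ general linear matrix over $R=k[X_1,\ldots,X_n]$. Then, for every $1\le t\le m-1$, the ideal $I_t(\mathcal{L})\subset R$ generated by the $t\times t$ minors of $\mathcal{L}$ has height $$\mathrm{ht}(I_t(\mathcal{L}))=\min\{n,\,(m-t+1)(m-t)\}.$$
   Context: General linear matrix: let $k$ be an infinite field and $m,n$ positive integers with $m(m-1)\ge n$. Let $\mathcal{Z}=(Z_{ij})$ be the $m\times(m-1)$ generic matrix, $S=k[Z_{ij}\mid 1\le i\le m,\,1\le j\le m-1]$, and $s=m(m-1)-n$. Take a regular sequence $L_1,\ldots,L_s\in S$ of linear forms whose entire set of coefficients is general (random). Then $R:=S/(L_1,\ldots,L_s)$ is a polynomial ring in $n$ variables over $k$, written $R=k[X_1,\ldots,X_n]$, and the general linear matrix $\mathcal{L}$ is the image of $\mathcal{Z}$ over $R$. (Equivalently, ordering entries row by row, the last $n$ entries of $\mathcal{L}$ may be taken to be $X_1,\ldots,X_n$ and the first $m(m-1)-n$ entries are linear forms in the $X_i$ whose total set of coefficients is general.) ''General'' has its usual meaning: an assertion about a general linear matrix means that there is a nonempty Zariski-open subset of the affine space of coefficients of $(L_1,\ldots,L_s)$ such that the assertion holds for every choice of coefficients in it. *)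

(* Defs.v *)
From HB Require Import structures.
From mathcomp Require Import all_boot all_order all_algebra.
From mathcomp Require Import mpoly.

Set Implicit Arguments.
Unset Strict Implicit.
Unset Printing Implicit Defensive.

Import GRing.Theory.
Local Open Scope ring_scope.

Definition infinite_type (T : eqType) : Prop :=
  forall s : seq T, exists x : T, x \notin s.

Section CommutativeAlgebra.
Variable R : comNzRingType.

Definition ideal_gen (A : R -> Prop) (x : R) : Prop :=
  exists2 s : seq (R * R),
    (forall p, p \in s -> A p.2) & x = \sum_(p <- s) p.1 * p.2.

(* [idealr_closed] includes that [1] is not a member. *)
Definition is_prime_ideal (P : {pred R}) : Prop :=
  idealr_closed P /\ prime_idealr_closed P.

Definition strict_sub (P Q : {pred R}) : Prop :=
  {subset P <= Q} /\ exists2 x, x \in Q & x \notin P.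

(* C 0 < C 1 < ... < C l = P; the values of C beyond l are irrelevant. *)
Definition prime_chain_to (P : {pred R}) (l : nat) : Prop :=
  exists C : nat -> {pred R},
    [/\ forall i, (i <= l)%N -> is_prime_ideal (C i),
        forall i, (i < l)%N -> strict_sub (C i) (C i.+1)
      & C l =i P].

Definition prime_height (P : {pred R}) (h : nat) : Prop :=
  prime_chain_to P h /\ forall l, prime_chain_to P l -> (l <= h)%N.

(* The least height of a prime containing I.  Primes of infinite height, for
   which [prime_height] holds of no natural number, do not affect a finite
   minimum.  No h qualifies for the unit ideal. *)
Definition ideal_height (I : R -> Prop) (h : nat) : Prop :=
  let contains (P : {pred R}) := forall x, I x -> x \in P in
  (exists P, [/\ is_prime_ideal P, contains P & prime_height P h]) /\
  (forall P h', is_prime_ideal P -> contains P -> prime_height P h' ->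
     (h <= h')%N).

Definition regular_sequence (s : nat) (a : 'I_s -> R) : Prop :=
  (forall (i : 'I_s) (x : R),
     let J := ideal_gen (fun y => exists2 j : 'I_s, (j < i)%N & y = a j) in
     J (a i * x) -> J x) /\
  ~ ideal_gen (fun y => exists j, y = a j) 1.

Definition is_minor (p q t : nat) (A : 'M[R]_(p, q)) (x : R) : Prop :=
  exists (f : 'I_t -> 'I_p) (g : 'I_t -> 'I_q),
    [/\ forall i j : 'I_t, (i < j)%N -> (f i < f j)%N,
        forall i j : 'I_t, (i < j)%N -> (g i < g j)%N
      & x = \det (mxsub f g A)].

Definition minors_ideal (p q t : nat) (A : 'M[R]_(p, q)) : R -> Prop :=
  ideal_gen (is_minor t A).

End CommutativeAlgebra.

(* The affine space of p x q matrices has coordinate ring {mpoly k[p * q]};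
   U is the complement of the common zero locus of the family F. *)
Definition zariski_open (k : fieldType) (p q : nat)
    (U : 'M[k]_(p, q) -> Prop) : Prop :=
  exists F : {mpoly k[p * q]} -> Prop,
    forall c, U c <-> exists2 f, F f & f.@[fun i => mxvec c 0 i] != 0.

Section GeneralLinearMatrix.
Variables (k : fieldType) (n m : nat).

Let N := (m * m.-1)%N.
Let s := (N - n)%N.

(* [mxvec_index] numbers the entries row by row. *)
Definition generic_matrix : 'M[{mpoly k[N]}]_(m, m.-1) :=
  \matrix_(i, j) 'X_(mxvec_index i j).

Definition linear_forms (c : 'M[k]_(s, N)) (i : 'I_s) : {mpoly k[N]} :=
  \sum_(j < N) c i j *: 'X_j.

(* Identification of k[Z] / (L_1, ..., L_s) with k[X_1, ..., X_n]: a surjective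
   k-algebra morphism with kernel (L_1, ..., L_s), sending the variables to
   linear forms. *)
Definition quotient_presentation (c : 'M[k]_(s, N))
    (phi : {lrmorphism {mpoly k[N]} -> {mpoly k[n]}}) : Prop :=
  [/\ forall y, exists x, phi x = y,
      forall x,
        phi x = 0 <-> ideal_gen (fun y => exists i, y = linear_forms c i) x
    & forall j : 'I_N, phi 'X_j \is 1.-homog].

(* That the general L_i form a regular sequence with quotient a polynomial ring
   in n variables is part of the claim, so that the quantification over phi is
   not vacuous; phi is universally quantified because the identification of the
   quotient with k[X_1, ..., X_n] is only unique up to a linear change of
   variables. *)
Definition for_general_linear_matrix
    (Pr : 'M[{mpoly k[n]}]_(m, m.-1) -> Prop) : Prop :=
  exists U : 'M[k]_(s, N) -> Prop,
    [/\ zariski_open U, exists c, U c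
      & forall c, U c ->
          [/\ regular_sequence (linear_forms c),
              exists phi, quotient_presentation c phi
            & forall phi, quotient_presentation c phi ->
                Pr (map_mx phi generic_matrix)]].

End GeneralLinearMatrix.

(* Main.v *)
From HB Require Import structures.
Require Import Defs.
From mathcomp Require Import all_boot all_order all_algebra all_fingroup.
From mathcomp Require Import mpoly zify.
From mathcomp Require boolp classical_sets.

(** Put N = m (m - 1), h = (m - t + 1) (m - t), delta = N - h, s = N - n and
    d = max (0, delta - s), and let Gamma be the set of the delta cells (i, j)
    with min (i, j) < t - 1, counting from 0.

    On each diagonal of the generic matrix consider the Vandermonde combinations
    sum_p a_p^e z_p with e < t - 1, that is, one linear form for each cell of
    Gamma.  A prime containing these forms and the t-minors contains all
    variables: going through the diagonals in order, the t-minors on a diagonal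
    are triangular modulo the previous diagonals, so at most t - 1 entries of it
    are nonzero modulo the prime, and these vanish by Vandermonde.  Hence some
    power of the irrelevant ideal lies in I_t + (the delta forms).  In a fixed
    degree this is an open condition on the forms.  So, for general L_i, the L_i
    extend to coordinates y_0, y_1, ... of k[Z] with y_i = L_i for i < s, such
    that k[Z] is finite over k[y_0, ..., y_(delta-1)] modulo I_t.

    It follows that n - d of the coordinates y_s, y_(s+1), ... of
    k[X_1, ..., X_n] are integral modulo I_t over the d first ones.  The
    contractions of a prime P containing I_t to the first d, d + 1, ..., n
    coordinates, extended back to the whole ring, then form a strict chain of
    n - d + 1 primes.  Conversely, if d elements are independent modulo P, then
    adding to them one element for each step of a chain of primes below P keeps
    them independent, so the chain has length at most n - d.

    A prime P of the second kind exists because I_t does not meet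
    k[y_s, ..., y_(delta-1)].  Indeed the kernel K of Z |-> A B, where A has
    t - 1 columns, is a prime containing I_t modulo which the variables in Gamma
    are independent; by the two estimates on chains y_0, ..., y_(delta-1) are
    independent modulo K, and the determinant trick over k[y_0, ..., y_(delta-1)]
    allows setting y_0 = ... = y_(s-1) = 0. *)

Set Implicit Arguments.
Unset Strict Implicit.
Unset Printing Implicit Defensive.

Import GRing.Theory.
Local Open Scope ring_scope.

(** * Ideals and primes *)

Section Ideals.
Variable R : comNzRingType.
Implicit Types (A J : R -> Prop) (P Q : {pred R}).

Definition is_ideal J : Prop := J 0 /\ forall a x y, J x -> J y -> J (a * x + y).

Lemma is_idealD J x y : is_ideal J -> J x -> J y -> J (x + y).
Proof. by move=> [_ JD] Jx Jy; rewrite -[x]mul1r; apply: JD. Qed.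

Lemma is_idealM J a x : is_ideal J -> J x -> J (a * x).
Proof. by move=> [J0 JD] Jx; rewrite -[_ * _]addr0; apply: JD. Qed.

Lemma is_idealN J x : is_ideal J -> J x -> J (- x).
Proof. by move=> Ji Jx; rewrite -mulN1r; apply: is_idealM. Qed.

Lemma is_idealB J x y : is_ideal J -> J x -> J y -> J (x - y).
Proof. by move=> Ji Jx Jy; apply: is_idealD => //; apply: is_idealN. Qed.

Lemma is_ideal_sum J I (r : seq I) (Pr : pred I) (F : I -> R) :
  is_ideal J -> (forall i, Pr i -> J (F i)) -> J (\sum_(i <- r | Pr i) F i).
Proof.
move=> Ji JF; apply: big_ind => //; first by case: Ji.
by move=> x y; apply: is_idealD.
Qed.

Lemma ideal_gen_is_ideal A : is_ideal (ideal_gen A).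
Proof.
split; first by exists [::] => //; rewrite big_nil.
move=> a x y [s sA ->] [s' s'A ->].
exists ([seq (a * p.1, p.2) | p <- s] ++ s').
  move=> p; rewrite mem_cat => /orP[/mapP[p' p's ->] /=|]; first exact: sA.
  exact: s'A.
rewrite big_cat big_map mulr_sumr /=; congr (_ + _).
by apply: eq_bigr => p _; rewrite mulrA.
Qed.

Lemma mem_ideal_gen A x : A x -> ideal_gen A x.
Proof.
move=> Ax; exists [:: (1, x)]; first by move=> p; rewrite inE => /eqP ->.
by rewrite big_seq1 mul1r.
Qed.

Lemma ideal_gen_min A J :
  is_ideal J -> (forall x, A x -> J x) -> forall x, ideal_gen A x -> J x.
Proof.
move=> Ji AJ x [s sA ->]; rewrite big_seq_cond.
by apply: is_ideal_sum => // p /andP[ps _]; apply: is_idealM => //; apply/AJ/sA.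
Qed.

Lemma is_prime_ideal_is_ideal P : is_prime_ideal P -> is_ideal (fun x => x \in P).
Proof. by case=> -[P0 _ PD] _; split => // a x y Px Py; apply: PD. Qed.

(** Turns membership in a prime into vanishing in the domain R/P. The inverse that [idomainType]
    demands is chosen classically, as no decision procedure for the units of the quotient is
    given. *)
Lemma prime_quotient P : is_prime_ideal P ->
  exists (D : idomainType) (f : {rmorphism R -> D}), forall x, (x \in P) = (f x == 0).
Proof.
move=> [Pi PM].
pose Pid := isIdealr.Build R P Pi.
pose Ppr := isPrimeIdealrClosed.Build R P PM.
pose I : prime_idealr R := HB.pack P Pid Ppr.
pose D0 : comNzRingType := {ideal_quot I}.
pose inv (x : D0) :=
  if boolp.pselect (exists y, y * x == 1) is left h then xchoose h else x.
pose unit : pred D0 := fun x => boolp.asbool (exists y, y * x == 1).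
have mulVx : {in unit, left_inverse 1 inv *%R}.
  move=> x /boolp.asboolP ux; rewrite /inv; case: boolp.pselect => // h.
  exact/eqP/(xchooseP h).
have unitP (x y : D0) : y * x = 1 -> unit x.
  by move=> yx; apply/boolp.asboolP; exists y; apply/eqP.
have inv_out : {in [predC unit], inv =1 id}.
  move=> x; rewrite inE => /boolp.asboolP ux.
  by rewrite /inv; case: boolp.pselect.
pose D1 : comUnitRingType := HB.pack {ideal_quot I}
  (GRing.ComNzRing_hasMulInverse.Build {ideal_quot I} mulVx unitP inv_out).
pose f : {rmorphism R -> D0} := \pi_{ideal_quot I}%qT.
have f0 x : (f x == 0) = (x \in P).
  by have := Quotient.idealrBE I x 0; rewrite subr0 -[\pi_{ideal_quot I}%qT 0]/(f 0) rmorph0.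
have dom (x y : D1) : x * y = 0 -> (x == 0) || (y == 0).
  move=> /eqP; rewrite -[x]reprK -[y]reprK -[_ * _](rmorphM f).
  by rewrite !f0 => /PM.
pose D : idomainType := HB.pack {ideal_quot I} D1 (GRing.ComUnitRing_isIntegral.Build D1 dom).
by exists D, f.
Qed.

End Ideals.

Section Primes.
Variable R : comNzRingType.
Implicit Types (A J : R -> Prop) (P Q : {pred R}).

Lemma kernel_prime (D : idomainType) (f : {rmorphism R -> D}) :
  is_prime_ideal [pred x | f x == 0].
Proof.
split; last by move=> x y; rewrite !inE rmorphM mulf_eq0.
split; rewrite ?inE ?rmorph0 ?rmorph1 ?oner_eq0 //.
by move=> a x y; rewrite !inE rmorphD rmorphM => /eqP -> /eqP ->; rewrite mulr0 addr0.
Qed.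

Lemma preim_prime (R' : comNzRingType) (f : {rmorphism R -> R'}) (P : {pred R'}) :
  is_prime_ideal P -> is_prime_ideal [pred x | f x \in P].
Proof.
move=> [[P0 P1 PD] PM]; split; last by move=> x y; rewrite !inE rmorphM => /PM.
split; rewrite ?inE ?rmorph0 ?rmorph1 //.
by move=> a x y; rewrite !inE rmorphD rmorphM; apply: PD.
Qed.

(** Zorn's lemma yields an ideal maximal among those that contain J and miss the multiplicative set
    S; such an ideal is prime. *)
Lemma prime_avoiding J (S : R -> Prop) :
  is_ideal J -> S 1 -> (forall x y, S x -> S y -> S (x * y)) ->
  (forall x, J x -> ~ S x) ->
  exists P, [/\ is_prime_ideal P, forall x, J x -> x \in P
               & forall x, x \in P -> ~ S x].
Proof.
move=> Ji S1 SM JS.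
(* The empty set is allowed in [good] so that the union of an empty chain is. *)
pose good (X : R -> Prop) :=
  [/\ forall a x y, X x -> X y -> X (a * x + y),
      forall x y, X x -> J y -> X (x + y) & forall x, X x -> ~ S x].
have [X [[XD XJ XS] Xmax]] : exists A, good A /\
    forall B, classical_sets.proper A B -> ~ good B.
  apply: (@classical_sets.Zorn_bigcup R good) => F Fgood Ftot; split.
  - move=> a x y [X FX Xx] [Y FY Yy].
    have [XY|YX] := Ftot _ _ FX FY.
      by exists Y => //; have [YD _ _] := Fgood _ FY; apply: YD => //; apply: XY.
    by exists X => //; have [XD _ _] := Fgood _ FX; apply: XD => //; apply: YX.
  - by move=> x y [X FX Xx] Jy; exists X => //; have [_ XJ _] := Fgood _ FX; apply: XJ.
  - by move=> x [X FX Xx]; have [_ _] := Fgood _ FX; apply.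
have goodJ : good J.
  by split=> [a x y|x y|] //; [apply: Ji.2 | apply: is_idealD].
have [x0 Xx0] : exists x, X x.
  apply: boolp.contrapT => nX; apply: (Xmax J) => //; split.
    by move=> x Xx; exfalso; apply: nX; exists x.
  by move=> /(_ 0); case: Ji => J0 _ /(_ J0) X0; exfalso; apply: nX; exists 0.
have X0 : X 0 by rewrite -[0](addNr x0) -mulN1r; apply: XD.
have Xi : is_ideal X by split.
have JX x : J x -> X x by move=> Jx; rewrite -[x]add0r; apply: XJ.
(* By maximality, adjoining u to X gives an ideal that meets S. *)
have hit u : ~ X u -> exists a x, X x /\ S (a * u + x).
  move=> nXu; apply: boolp.contrapT => nS.
  apply: (Xmax (fun z => exists a x, X x /\ z = a * u + x)).
    split; first by move=> x Xx; exists 0, x; rewrite mul0r add0r.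
    by move=> AX; apply/nXu/AX; exists 1, 0; rewrite mul1r addr0.
  split.
  - move=> a _ _ [b [x [Xx ->]]] [c [y [Xy ->]]].
    exists (a * b + c), (a * x + y); split; first exact: XD.
    by rewrite mulrDr mulrDl !mulrA addrACA.
  - move=> _ y [b [x [Xx ->]]] Jy; exists b, (x + y); split; first exact: XJ.
    by rewrite addrA.
  - by move=> _ [b [x [Xx ->]]] Sx; apply: nS; exists b, x.
exists (fun x => boolp.asbool (X x)); split.
- split; first split.
  + exact/boolp.asboolP.
  + by apply/boolp.asboolP => /XS.
  + by move=> a x y /boolp.asboolP Xx /boolp.asboolP Xy; apply/boolp.asboolP/XD.
  move=> u v /boolp.asboolP Xuv; apply/orP; apply: boolp.contrapT.
  move=> nuv.
  have [a [x [Xx Sx]]] : exists a x, X x /\ S (a * u + x).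
    by apply: hit => Xu; apply: nuv; left; apply/boolp.asboolP.
  have [b [y [Xy Sy]]] : exists b y, X y /\ S (b * v + y).
    by apply: hit => Xv; apply: nuv; right; apply/boolp.asboolP.
  (* The product of the two elements of S lies in X, because u v does. *)
  apply: (XS _ _ (SM _ _ Sx Sy)).
  rewrite mulrDl mulrDr mulrACA.
  by do 2?[apply: is_idealD => //]; do ?[exact: is_idealM]; rewrite mulrC; apply: is_idealM.
- by move=> x /JX Xx; apply/boolp.asboolP.
- by move=> x /boolp.asboolP /XS.
Qed.

(** By Cramer's rule det M multiplies every e_i into J, and 1 is a combination of the e_i modulo
    J. *)
Lemma det_in_ideal J r (e : 'I_r -> R) (M : 'M[R]_r) :
  is_ideal J -> (forall i, J (\sum_j M i j * e j)) ->
  (exists b : 'I_r -> R, J (1 - \sum_i b i * e i)) -> J (\det M).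
Proof.
move=> Ji JM [b Jb].
have Je i : J (\det M * e i).
  have -> : \det M * e i = \sum_j (\adj M) i j * \sum_l M j l * e l.
    transitivity (\sum_l ((\adj M) *m M) i l * e l).
      rewrite mul_adj_mx (bigD1 i) //= mxE eqxx mulr1n big1 ?addr0 // => l li.
      by rewrite mxE eq_sym (negbTE li) mulr0n mul0r.
    under eq_bigr => l _ do rewrite mxE mulr_suml.
    rewrite exchange_big; apply: eq_bigr => j _; rewrite mulr_sumr.
    by apply: eq_bigr => l _; rewrite mulrA.
  by apply: is_ideal_sum => // j _; apply: is_idealM.
have -> : \det M = \det M * (1 - \sum_i b i * e i) + \sum_i b i * (\det M * e i).
  rewrite mulrBr mulr1 mulr_sumr -addrA -sumrN -big_split /= big1 ?addr0 // => i _.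
  by rewrite mulrCA addNr.
by apply: is_idealD => //; [apply: is_idealM | apply: is_ideal_sum => // i _; apply: is_idealM].
Qed.

Section FiniteAlgebra.
Variables (B : comNzRingType) (f : {rmorphism B -> R}) (J : R -> Prop).
Variables (r : nat) (e : 'I_r -> R).
Hypothesis Ji : is_ideal J.
Hypothesis gen : forall x, exists b : 'I_r -> B, J (x - \sum_i f (b i) * e i).

(** The determinant trick: x acts on the generators e_i modulo J through a matrix A over B, so det
    (x - A) lies in J. *)
Lemma integral_mod_ideal x : exists2 p, p \is monic & J ((map_poly f p).[x]).
Proof.
have [M JM] : exists M : 'I_r -> 'I_r -> B,
    forall i, J (x * e i - \sum_j f (M i j) * e j).
  by apply: (fin_all_exists (P := fun i b => J (x * e i - \sum_j f (b j) * e j))) => i.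
pose A := \matrix_(i, j) M i j.
exists (char_poly A); first exact: char_poly_monic.
have -> : (map_poly f (char_poly A)).[x] = \det (x%:M - map_mx f A).
  rewrite -[LHS]/((horner_eval x \o map_poly f) (char_poly A)) /char_poly -det_map_mx.
  congr (\det _); apply/matrixP => i j; rewrite !mxE /= rmorphB rmorphMn /= map_polyX.
  rewrite map_polyC /= /horner_eval hornerD hornerN hornerC hornerMn hornerX.
  by [].
apply: (@det_in_ideal _ r e) => //; last first.
  by have [b Jb] := gen 1; exists (fun i => f (b i)).
move=> i; have := JM i; congr J.
rewrite -sumrN -[x * e i](_ : \sum_j (x *+ (i == j)) * e j = _).
  by rewrite -big_split; apply: eq_bigr => j _; rewrite !mxE /= mulrBl.
rewrite (bigD1 i) //= eqxx mulr1n big1 ?addr0 // => j ji.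
by rewrite eq_sym (negbTE ji) mulr0n mul0r.
Qed.

End FiniteAlgebra.

End Primes.

(** The inverse g is a mere function, as [bijective] provides no more; its compatibility with the
    ring operations is derived. *)
Lemma prime_chain_iso (R R' : comNzRingType) (f : {rmorphism R -> R'})
    (g : R' -> R) (P : {pred R'}) l (C : nat -> {pred R}) :
  cancel f g -> cancel g f ->
  [/\ forall i, (i <= l)%N -> is_prime_ideal (C i),
      forall i, (i < l)%N -> strict_sub (C i) (C i.+1)
    & C l =i [pred x | f x \in P]] ->
  let C' i := [pred x | g x \in C i] in
  [/\ forall i, (i <= l)%N -> is_prime_ideal (C' i),
      forall i, (i < l)%N -> strict_sub (C' i) (C' i.+1)
    & C' l =i P].
Proof.
move=> fK gK [Cp Cs Cl] C'.
have gD x y : g (x + y) = g x + g y by apply: (can_inj fK); rewrite rmorphD !gK.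
have gM x y : g (x * y) = g x * g y by apply: (can_inj fK); rewrite rmorphM !gK.
have g0 : g 0 = 0 by apply: (can_inj fK); rewrite rmorph0 !gK.
have g1 : g 1 = 1 by apply: (can_inj fK); rewrite rmorph1 !gK.
split=> [i /Cp[[C0 C1 CD] CM]|i /Cs[sC [x xC' xC]]|x]; last by rewrite inE Cl inE gK.
  split; last by move=> x y; rewrite !inE gM; apply: CM.
  by split; rewrite ?inE ?g0 ?g1 // => a x y; rewrite !inE gD gM; apply: CD.
by split=> [y|]; [rewrite !inE; apply: sC | exists (f x); rewrite inE fK].
Qed.

(** * Linear algebra over a field *)

Section FieldLemmas.
Variable k : fieldType.

Lemma underdetermined (T1 T2 : finType) (M : T1 -> T2 -> k) :
  (#|T2| < #|T1|)%N ->
  exists2 v : T1 -> k, exists i, v i != 0 & forall j, \sum_i v i * M i j = 0.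
Proof.
move=> lt21; pose A := \matrix_(i < #|T1|, j < #|T2|) M (enum_val i) (enum_val j).
have : kermx A != 0.
  rewrite -mxrank_eq0 mxrank_ker subn_eq0 -ltnNge.
  exact: leq_ltn_trans (rank_leq_col A) lt21.
move=> /rowV0Pn [u /sub_kermxP uA u0]; exists (fun i => u 0 (enum_rank i)).
  have /rV0Pn [i ui] := u0; exists (enum_val i); by rewrite enum_valK.
move=> j; transitivity ((u *m A) 0 (enum_rank j)); last by rewrite uA mxE.
rewrite mxE [RHS](reindex _ (onW_bij _ (@enum_rank_bij T1))).
by apply: eq_bigr => i _; rewrite mxE !enum_rankK.
Qed.

(** Lagrange interpolation: the moments, weighted by the coefficients of the polynomial that
    vanishes at all nodes but a u, add up to a nonzero scalar times z u. *)
Lemma vandermonde_zero (D : comNzRingType) (f : {rmorphism k -> D}) (T : finType)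
    (B : {set T}) (a : T -> k) (z : T -> D) :
  {in B &, injective a} ->
  (forall e, (e < #|B|)%N -> \sum_(u in B) f (a u ^+ e) * z u = 0) ->
  forall u, u \in B -> z u = 0.
Proof.
move=> a_inj zB u uB.
pose p : {poly k} := \prod_(v in B :\ u) ('X - (a v)%:P).
have sz_p : size p = #|B| by rewrite /p -big_enum size_prod_XsubC -cardE (cardsD1 u B) uB.
have : \sum_(v in B) f p.[a v] * z v = 0.
  transitivity (\sum_(e < size p) f p`_e * (\sum_(v in B) f (a v ^+ e) * z v)).
    under [RHS]eq_bigr => e _ do rewrite mulr_sumr.
    rewrite exchange_big; apply: eq_bigr => v _.
    rewrite horner_coef rmorph_sum mulr_suml; apply: eq_bigr => e _.
    by rewrite rmorphM mulrA.
  by apply: big1 => e _; rewrite zB ?mulr0 // -sz_p.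
rewrite (bigD1 u) //= big1 ?addr0 => [|v /andP[vB vu]]; last first.
  suff -> : p.[a v] = 0 by rewrite rmorph0 mul0r.
  rewrite horner_prod (bigD1 v) /=; last by rewrite !inE vu.
  by rewrite !hornerE subrr mul0r.
have pu : p.[a u] != 0.
  rewrite horner_prod; apply/prodf_neq0 => v; rewrite !inE => /andP[vu vB].
  by rewrite !hornerE subr_eq0; apply: contra_neq vu => /a_inj ->.
move=> /(congr1 (fun x => f (p.[a u])^-1 * x)).
by rewrite mulr0 mulrA -rmorphM mulVf // rmorph1 mul1r.
Qed.

Hypothesis k_inf : infinite_type k.

Lemma infinite_uniq_seq b : exists2 s : seq k, uniq s & size s = b.
Proof.
elim: b => [|b [s us sz]]; first by exists [::].
by have [x xs] := k_inf s; exists (x :: s); rewrite /= ?xs ?us ?sz.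
Qed.

End FieldLemmas.

(** * Substitution and evaluation of polynomials *)

Section Substitution.
Variable k : fieldType.

Lemma mpoly_rmorph_ext n (R : nzRingType) (f g : {rmorphism {mpoly k[n]} -> R}) :
  (forall c, f c%:MP = g c%:MP) -> (forall i, f 'X_i = g 'X_i) -> f =1 g.
Proof.
move=> fgC fgX p; rewrite [p]mpolyE !rmorph_sum; apply: eq_bigr => m _.
rewrite -mul_mpolyC !rmorphM fgC mpolyXE_id !rmorph_prod; congr (_ * _).
by apply: eq_bigr => i _; rewrite !rmorphXn /= fgX.
Qed.

Definition subst a b (h : 'I_a -> {mpoly k[b]}) : {mpoly k[a]} -> {mpoly k[b]} :=
  mmap (@mpolyC b k) h.

HB.instance Definition _ a b h := GRing.RMorphism.copy (@subst a b h) (mmap (@mpolyC b k) h).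

Lemma substC a b (h : 'I_a -> {mpoly k[b]}) c : subst h c%:MP = c%:MP.
Proof. exact: mmapC. Qed.

Lemma substX a b (h : 'I_a -> {mpoly k[b]}) i : subst h 'X_i = h i.
Proof. by rewrite /subst mmapX mmap1U. Qed.

Lemma meval_subst a b (h : 'I_a -> {mpoly k[b]}) p v :
  (subst h p).@[v] = p.@[fun i => (h i).@[v]].
Proof.
apply: (mpoly_rmorph_ext (f := meval v \o subst h)) p => [c|i] /=.
  by rewrite substC !mevalC.
by rewrite substX !mevalXU.
Qed.

Definition extend_last T a (h : 'I_a -> T) (x : T) (i : 'I_a.+1) : T :=
  if unlift ord_max i is Some j then h j else x.

Lemma extend_last_lift T a (h : 'I_a -> T) x j : extend_last h x (lift ord_max j) = h j.
Proof. by rewrite /extend_last liftK. Qed.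

Lemma extend_last_max T a (h : 'I_a -> T) x : extend_last h x ord_max = x.
Proof. by rewrite /extend_last unlift_none. Qed.

Definition split_last a : {mpoly k[a.+1]} -> {poly {mpoly k[a]}} :=
  mmap (polyC \o @mpolyC a k) (extend_last (fun j => ('X_j)%:P) 'X).

HB.instance Definition _ a := GRing.RMorphism.copy (@split_last a)
  (mmap (polyC \o @mpolyC a k) (extend_last (fun j => ('X_j)%:P) 'X)).

Lemma horner_split_last a (R : comNzRingType) (f : {rmorphism k -> R})
    (h : 'I_a -> R) x p :
  (map_poly (mmap f h) (split_last p)).[x] = mmap f (extend_last h x) p.
Proof.
apply: (mpoly_rmorph_ext (f := horner_eval x \o map_poly (mmap f h) \o @split_last a)) p
  => [c|i] /=.
  by rewrite /split_last mmapC /= map_polyC /= /horner_eval hornerC !mmapC.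
rewrite /split_last !mmapX !mmap1U /horner_eval.
case: (unliftP ord_max i) => [j ->|->].
  by rewrite !extend_last_lift map_polyC /= hornerC mmapX mmap1U.
by rewrite !extend_last_max map_polyX hornerX.
Qed.

Lemma split_last_eq0 a (p : {mpoly k[a.+1]}) : split_last p = 0 -> p = 0.
Proof.
move=> p0; have := horner_split_last (@mpolyC a.+1 k) (fun j => 'X_(lift ord_max j)) 'X_ord_max p.
rewrite p0 rmorph0 horner0 => {p0} ->.
apply: (mpoly_rmorph_ext (f := idfun) (g := subst _)) p => [c|i] /=; first by rewrite substC.
rewrite substX; case: (unliftP ord_max i) => [j ->|->].
  by rewrite extend_last_lift.
by rewrite extend_last_max.
Qed.

Hypothesis k_inf : infinite_type k.

(** Induction on n: at a point where the leading coefficient in the last variable is nonzero, F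
    becomes a nonzero univariate polynomial, which has finitely many roots. *)
Lemma mpoly_neq0_point n (F : {mpoly k[n]}) : F != 0 -> exists v, F.@[v] != 0.
Proof.
elim: n F => [|n IHn] F F0.
  exists (fun _ => 0); rewrite [F]nvar0_mpolyC mevalC.
  by apply: contra_neq F0 => F0; rewrite [F]nvar0_mpolyC F0 mpolyC0.
have G0 : lead_coef (split_last F) != 0.
  by rewrite lead_coef_eq0; apply: contra_neq F0; apply: split_last_eq0.
have [v vG] := IHn _ G0.
pose p := map_poly (meval v) (split_last F).
have p0 : p != 0.
  apply: contra_neq vG => p0; rewrite lead_coefE -coef_map /= -/p p0.
  by rewrite coef0.
have [s us sz] := infinite_uniq_seq k_inf (size p).
have [x xp] : exists x, p.[x] != 0.
  have /allPn[x _ xp] : ~~ all (root p) s.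
    by apply/negP => /(max_poly_roots p0)/(_ us); rewrite sz ltnn.
  by exists x.
by exists (extend_last v x); rewrite /meval -horner_split_last.
Qed.

End Substitution.

(** * Upper bound for the length of chains of primes *)

Section Chains.
Variable k : fieldType.
Local Notation A n := {mpoly k[n]}.

Definition alg_indep_mod n a (w : 'I_a -> A n) (J : A n -> Prop) : Prop :=
  forall F : A a, J (subst w F) -> F = 0.

Lemma mpoly_monE n (F : A n) b m : (msize F <= b)%N -> F@_m != 0 -> forall i, (m i < b)%N.
Proof.
move=> Fb; rewrite -mcoeff_msupp => /msize_mdeg_lt mF i.
apply: leq_trans Fb; apply: leq_ltn_trans mF.
by rewrite mdegE (bigD1 i) //= leq_addr.
Qed.

Lemma msize_prodX_le n a (w : 'I_a -> A n) (D q : nat) (e : 'I_a -> nat) :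
  (forall i, (msize (w i) <= D.+1)%N) -> (forall i, (e i <= q)%N) ->
  (msize (\prod_i w i ^+ e i) <= (a * (q * D)).+1)%N.
Proof.
move=> wD eq.
have msM (x y : A n) c d : (msize x <= c.+1 -> msize y <= d.+1 -> msize (x * y) <= (c + d).+1)%N.
  move=> xc yd; have [->|x0] := eqVneq x 0; first by rewrite mul0r msize0.
  have [->|y0] := eqVneq y 0; first by rewrite mulr0 msize0.
  rewrite msizeM //; apply: (@leq_trans (c.+1 + d.+1).-1); last by rewrite addnS addSn.
  by rewrite -!subn1 leq_sub2r // leq_add.
have wX i : (msize (w i ^+ e i) <= (q * D).+1)%N.
  apply: (@leq_trans (e i * D).+1); last by rewrite ltnS leq_mul2r eq orbT.
  elim: (e i) => [|c IHc]; first by rewrite expr0 msize1.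
  by rewrite exprS mulSn; apply: msM.
rewrite -[a in (a * _)%N]card_ord -sum_nat_const.
apply: (big_ind2 (fun (x : A n) c => (msize x <= c.+1)%N)) => //; first by rewrite msize1.
by move=> x c y d; apply: msM.
Qed.

(** Dimension count: if n < a, the q^a monomials in w with exponents below q outnumber the b^n
    monomials in X that can occur in them, which forces a linear relation. *)
Lemma alg_indep_le n a (w : 'I_a -> A n) : alg_indep_mod w (eq^~ 0) -> (a <= n)%N.
Proof.
move=> w_ind; rewrite leqNgt; apply/negP => lt_na.
pose D := \max_i msize (w i).
have wD i : (msize (w i) <= D.+1)%N by apply: leqW; apply: leq_bigmax.
(* A monomial in w with exponents below q has degree at most a (q - 1) D < b, and q > E^n gives b^n
   = q^n E^n < q^(n+1). *)
pose E := (a * D).+1; pose q := (E ^ n).+1; pose b := (q * E)%N.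
pose mon (e : {ffun 'I_a -> 'I_q}) : 'X_{1..a} := [multinom (e i : nat) | i < a].
pose mon' (e : {ffun 'I_n -> 'I_b}) : 'X_{1..n} := [multinom (e i : nat) | i < n].
have lt_card : (#|{: {ffun 'I_n -> 'I_b}}| < #|{: {ffun 'I_a -> 'I_q}}|)%N.
  rewrite !card_ffun !card_ord; apply: (@leq_trans (q ^ n.+1)%N); last by rewrite leq_pexp2l.
  by rewrite expnMn expnS mulnC ltn_mul2r expn_gt0 ltnSn.
have [v [e0 ve0] vM] := underdetermined
  (fun e e' => (subst w 'X_[mon e])@_(mon' e')) lt_card.
pose F : A a := \sum_e v e *: 'X_[mon e].
have mon_inj : injective mon.
  move=> e e' /mnmP ee'; apply/ffunP => i; apply: val_inj.
  by have := ee' i; rewrite !mnmE.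
have F_neq0 : F@_(mon e0) = v e0.
  rewrite /F raddf_sum (bigD1 e0) //= mcoeffZ mcoeffX eqxx mulr1 big1 ?addr0 // => e ee0.
  by rewrite mcoeffZ mcoeffX (inj_eq mon_inj) (negbTE ee0) mulr0.
suff F0 : F = 0 by move: ve0; rewrite -F_neq0 F0 mcoeff0 eqxx.
apply: w_ind; apply/mpolyP => m; rewrite mcoeff0.
have wF e : (msize (subst w 'X_[mon e]) <= b)%N.
  rewrite /subst mmapX /mmap1.
  apply: (@leq_trans (a * (q.-1 * D)).+1); last first.
    by rewrite /b /E mulnCA mulnS /= addSn ltnS mulSn addnA leq_addl.
  apply: msize_prodX_le => // i; rewrite mnmE -ltnS; exact: ltn_ord.
have Fm : (subst w F)@_m = \sum_e v e * (subst w 'X_[mon e])@_m.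
  rewrite /F rmorph_sum raddf_sum /=; apply: eq_bigr => e _.
  by rewrite -mul_mpolyC rmorphM /= substC mcoeffCM.
rewrite Fm; have [m_lt|m_ge] := boolP [forall i, (m i < b)%N].
  have -> : m = mon' [ffun i => Ordinal (forallP m_lt i)] by apply/mnmP => i; rewrite mnmE ffunE.
  exact: vM.
apply: big1 => e _; suff -> : (subst w 'X_[mon e])@_m = 0 by rewrite mulr0.
apply: contraNeq m_ge => m0; apply/forallP; exact: mpoly_monE (wF e) m0.
Qed.

(** Read a relation in Q as a polynomial in f. Modulo P only its constant term survives, so this
    term is zero by independence; then f divides the relation and can be cancelled, being outside
    the prime Q. *)
Lemma alg_indep_step n a (w : 'I_a -> A n) (P Q : {pred A n}) f :
  is_prime_ideal P -> is_prime_ideal Q -> {subset Q <= P} -> f \in P -> f \notin Q ->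
  alg_indep_mod w (fun x => x \in P) ->
  alg_indep_mod (extend_last w f) (fun x => x \in Q).
Proof.
move=> Pp Qp QP fP fQ w_ind F FQ; apply: split_last_eq0.
move: FQ; rewrite /subst -horner_split_last.
elim/poly_ind: (split_last F) => [//|G c IHG].
rewrite rmorphD rmorphM /= map_polyX map_polyC !hornerE => GcQ.
have Pi := is_prime_ideal_is_ideal Pp; have Qi := is_prime_ideal_is_ideal Qp.
have c0 : c = 0.
  apply: w_ind; set x := subst w c.
  have -> : x = (map_poly (subst w) G).[f] * f + x - (map_poly (subst w) G).[f] * f.
    by rewrite addrAC subrr add0r.
  by apply: (is_idealB Pi); [apply: QP | exact: (is_idealM _ Pi fP)].
move: GcQ; rewrite c0 /= mmap0 addr0 => /Qp.2 /orP[/IHG -> | ]; last by rewrite (negbTE fQ).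
by rewrite mul0r add0r.
Qed.

(** Going down the chain, each strict inclusion contributes one independent element; at the bottom
    [alg_indep_le] bounds their number. *)
Lemma chain_length_le n a (w : 'I_a -> A n) (P : {pred A n}) l :
  alg_indep_mod w (fun x => x \in P) -> prime_chain_to P l -> (a + l <= n)%N.
Proof.
move=> w_ind [C [Cp Cs Cl]].
have {w_ind} : alg_indep_mod w (fun x => x \in C l) by move=> F; rewrite Cl; apply: w_ind.
move: Cp Cs {Cl P}; elim: l a w => [|l IHl] a w Cp Cs w_ind.
  rewrite addn0; apply: (@alg_indep_le n a w) => F F0; apply: w_ind.
  by rewrite F0; have [[->]] := Cp 0%N isT.
have [sC [f fC fC']] := Cs l (leqnn _).
rewrite addnS -addSn; apply: (IHl _ (extend_last w f)).
- by move=> i il; apply: Cp; apply: leqW.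
- by move=> i il; apply: Cs; apply: leqW.
- by apply: (alg_indep_step (P := C l.+1)) => //; apply: Cp.
Qed.

End Chains.

(** * Construction of long chains of primes *)

Section LongChain.
Variables (k : fieldType) (n d : nat) (le_dn : (d <= n)%N).
Local Notation A n := {mpoly k[n]}.

Definition incl : A d -> A n := subst (fun i => 'X_(widen_ord le_dn i)).
HB.instance Definition _ := GRing.RMorphism.copy incl (subst (fun i => 'X_(widen_ord le_dn i))).

Section Contractions.
Variables (D : idomainType) (f : {rmorphism A n -> D}).

(* The kernel of [freeze j] is the extension to k[X_0, ..., X_(n-1)] of the
   contraction of ker f to k[X_0, ..., X_(j-1)]. *)
Definition freeze (j : nat) : A n -> {mpoly D[n]} :=
  mmap (@mpolyC n D \o f \o @mpolyC n k) (fun i => if (i < j)%N then (f 'X_i)%:MP else 'X_i).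
HB.instance Definition _ j := GRing.RMorphism.copy (freeze j)
  (mmap (@mpolyC n D \o f \o @mpolyC n k)
     (fun i => if (i < j)%N then (f 'X_i)%:MP else 'X_i)).

Lemma freezeX j i : freeze j 'X_i = if (i < j)%N then (f 'X_i)%:MP else 'X_i.
Proof. by rewrite /freeze mmapX mmap1U. Qed.

Lemma freeze_all x : freeze n x = (f x)%:MP.
Proof.
apply: (mpoly_rmorph_ext (g := @mpolyC n D \o f)) x => [c|i] /=.
  by rewrite /freeze mmapC.
by rewrite freezeX ltn_ord.
Qed.

Lemma freeze_incl j b : (d <= j)%N -> freeze j (incl b) = (f (incl b))%:MP.
Proof.
move=> dj; apply: (mpoly_rmorph_ext (f := freeze j \o incl) (g := @mpolyC n D \o f \o incl)) b
  => [c|i] /=; first by rewrite /incl substC /freeze mmapC.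
by rewrite /incl substX freezeX (leq_trans (ltn_ord i) dj).
Qed.

(** [freeze j] factors through [freeze i]: the variables between i and j are specialized to their
    images in D afterwards. *)
Lemma freeze_le i j x : (i <= j)%N -> freeze i x = 0 -> freeze j x = 0.
Proof.
move=> ij ix; pose g : {rmorphism {mpoly D[n]} -> {mpoly D[n]}} :=
  mmap (@mpolyC n D) (fun l : 'I_n => freeze j 'X_l).
suff -> : freeze j x = g (freeze i x) by rewrite ix rmorph0.
clear ix.
apply: (mpoly_rmorph_ext (g := g \o freeze i)) x => [c|l] /=.
  by rewrite /g /= /freeze !mmapC.
rewrite [in RHS]freezeX /g /=; case: ltnP => li; last by rewrite mmapX mmap1U.
by rewrite mmapC freezeX (leq_trans li ij).
Qed.

(** The coefficients of p become constants of D while X_j stays free, so the leading term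
    survives. *)
Lemma freeze_monic (j : 'I_n) (p : {poly A d}) :
  (d <= j)%N -> p \is monic -> freeze j ((map_poly incl p).['X_j]) != 0.
Proof.
move=> dj p_mon.
have -> : freeze j ((map_poly incl p).['X_j]) =
    \sum_(i < size p) f (incl p`_i) *: 'X_[U_(j) *+ i].
  rewrite horner_coef size_map_poly_id0; last first.
    by rewrite (monicP p_mon) rmorph1 oner_eq0.
  rewrite rmorph_sum; apply: eq_bigr => i _.
  rewrite rmorphM rmorphXn /= coef_map /= freeze_incl // freezeX ltnn.
  by rewrite mul_mpolyC mpolyXn.
apply/eqP => /(congr1 (mcoeff (U_(j) *+ (size p).-1))).
have p_gt0 : (0 < size p)%N by rewrite lt0n size_poly_eq0 monic_neq0.
have lt_last : ((size p).-1 < size p)%N by rewrite ltn_predL.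
rewrite mcoeff0 raddf_sum /= (bigD1 (Ordinal lt_last)) //= big1 => [|i i_last].
  rewrite mcoeffZ mcoeffX eqxx mulr1 addr0 -lead_coefE (monicP p_mon) !rmorph1.
  by apply/eqP; rewrite oner_eq0.
rewrite mcoeffZ mcoeffX; case: eqP => [/mnmP/(_ j)|_]; last by rewrite mulr0.
rewrite !mulmnE mnm1E eqxx !mul1n => iE; case/eqP: i_last; exact: val_inj.
Qed.

Lemma freeze_prime j : is_prime_ideal [pred x | freeze j x == 0].
Proof. exact: kernel_prime. Qed.

End Contractions.

(* Step i of the chain extends the contraction to the first d + i variables;
   a monic relation of X_(d + i) modulo P makes the inclusion strict. *)
Lemma contraction_chain (P : {pred A n}) :
  is_prime_ideal P ->
  (forall j : 'I_n, (d <= j)%N ->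
     exists2 p : {poly A d}, p \is monic & (map_poly incl p).['X_j] \in P) ->
  exists C : nat -> {pred A n},
    [/\ forall i, (i <= n - d)%N -> is_prime_ideal (C i),
        forall i, (i < n - d)%N -> strict_sub (C i) (C i.+1),
        C (n - d)%N =i P & forall b, incl b \in P -> incl b \in C 0%N].
Proof.
move=> Pp mon; have [D [f fP]] := prime_quotient Pp.
exists (fun i => [pred x | freeze f (d + i) x == 0] : {pred A n}); split.
- by move=> i _; apply: freeze_prime.
- move=> i lt_i; split.
    by move=> x; rewrite !inE => /eqP ix; rewrite (freeze_le _ ix) // addnS.
  have lt_in : (d + i < n)%N by rewrite -ltn_subRL.
  have [p p_mon pP] := mon (Ordinal lt_in) (leq_addr _ _).
  exists ((map_poly incl p).['X_(Ordinal lt_in)]); last first.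
    by rewrite inE (freeze_monic _ (j := Ordinal lt_in)) ?leq_addr.
  rewrite inE; move: pP; rewrite fP => /eqP pP.
  suff -> : freeze f (d + i.+1) (map_poly incl p).['X_(Ordinal lt_in)] =
      (f (map_poly incl p).['X_(Ordinal lt_in)])%:MP by rewrite pP mpolyC0.
  rewrite horner_coef !rmorph_sum /=; apply: eq_bigr => l _.
  rewrite !rmorphM !rmorphXn /= freezeX /= addnS ltnSn; congr (_ * _).
  rewrite coef_map /= freeze_incl // -addnS leq_addr //.
- by move=> x; rewrite inE subnKC // freeze_all mpolyC_eq0 fP.
- by move=> b; rewrite inE fP addn0 freeze_incl // mpolyC_eq0.
Qed.

(** The chain of contractions in the coordinates [g 'X_j]. By the last conclusion its lowest prime
    still contains what P contains of the subring of the first d coordinates. *)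
Lemma long_chain (g : {rmorphism A n -> A n}) (P : {pred A n}) :
  bijective g -> is_prime_ideal P ->
  (forall j : 'I_n, (d <= j)%N ->
     exists2 p : {poly A d}, p \is monic & (map_poly (g \o incl) p).[g 'X_j] \in P) ->
  exists C : nat -> {pred A n},
    [/\ forall i, (i <= n - d)%N -> is_prime_ideal (C i),
        forall i, (i < n - d)%N -> strict_sub (C i) (C i.+1),
        C (n - d)%N =i P & forall b, g (incl b) \in P -> g (incl b) \in C 0%N].
Proof.
move=> [h gK hK] Pp mon.
have [|C [Cp Cs Cl C0]] := contraction_chain (preim_prime g Pp).
  move=> j /mon[p p_mon pP]; exists p => //.
  by rewrite inE -horner_map -map_poly_comp.
exists (fun i => [pred x | h x \in C i] : {pred A n}).
have [Cp' Cs' Cl'] := prime_chain_iso gK hK (And3 Cp Cs Cl).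
by split=> // b; rewrite inE gK; apply: C0.
Qed.

End LongChain.

(** * Homogeneous systems of parameters *)

Section HomogeneousSystems.
Variables (k : fieldType) (N : nat).
Local Notation A n := {mpoly k[n]}.
Implicit Types (J : A N -> Prop).

Lemma split_mnm (w : 'X_{1..N}) r : (r <= mdeg w)%N ->
  exists w1 w2, w = (w1 + w2)%MM /\ mdeg w1 = r.
Proof.
elim: r => [_|r IHr lt_rw]; first by exists 0%MM, w; rewrite add0m mdeg0.
have [w1 [w2 [wE w1r]]] := IHr (ltnW lt_rw).
have [i w2i] : exists i, w2 i != 0%N.
  apply/existsP; rewrite -negb_forall; apply: contraTN lt_rw => /forallP w20.
  rewrite wE mdegD w1r (_ : mdeg w2 = 0%N) ?addn0 ?ltnn // mdegE big1 // => i _.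
  exact/eqP.
exists (w1 + U_(i))%MM, (w2 - U_(i))%MM; split; last by rewrite mdegD w1r mdeg1 addn1.
by rewrite wE -addmA [(U_(i) + _)%MM]addmC submK // lep1mP.
Qed.

Definition lform r (T : 'M[k]_(r, N)) (j : 'I_r) : A N := \sum_(i < N) T j i *: 'X_i.

Lemma lform_homog r (T : 'M[k]_(r, N)) j : lform T j \is 1.-homog.
Proof. by apply: rpred_sum => i _; apply: rpredZ; rewrite dhomogX /= mdeg1. Qed.

Section Delta.
Variables (delta : nat) (le_dN : (delta <= N)%N).
Local Notation wid := (widen_ord le_dN).

(* The first delta rows of T are a homogeneous system of parameters modulo J,
   witnessed in degree q + 1. *)
Definition params J (T : 'M[k]_N) (q : nat) : Prop :=
  forall w : 'X_{1..N}, mdeg w = q.+1 ->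
  exists2 g : 'I_delta -> A N, forall j, g j \is q.-homog
    & J ('X_[w] - \sum_j lform T (wid j) * g j).

Definition param_subst (T : 'M[k]_N) : A delta -> A N := subst (fun j => lform T (wid j)).
HB.instance Definition _ T := GRing.RMorphism.copy (param_subst T)
  (subst (fun j => lform T (wid j))).

(** The monomials of degree at most q, which will generate k[X] modulo J as a module over the
    parameters. *)
Definition gen_mon q (i : 'I_#|{: 'X_{1..N < q.+1}}|) : A N := 'X_[enum_val i].

(** Induction on the degree: a monomial of degree above q has a factor of degree q + 1, and
    rewriting this factor modulo J splits off a parameter and leaves forms of smaller degree. *)
Lemma params_finite J T q : is_ideal J -> params J T q -> forall x,
  exists b, J (x - \sum_i param_subst T (b i) * gen_mon (q := q) i).
Proof.
move=> Ji JT.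
pose fin x := exists b, J (x - \sum_i param_subst T (b i) * gen_mon (q := q) i).
have finD x y : fin x -> fin y -> fin (x + y).
  move=> [b Jb] [c Jc]; exists (fun i => b i + c i).
  have := is_idealD Ji Jb Jc; rewrite addrACA -opprD -big_split; congr (J (_ - _)).
  by apply: eq_bigr => i _; rewrite rmorphD mulrDl.
have fin_sum (I : Type) (r : seq I) (Pr : pred I) F :
    (forall i, Pr i -> fin (F i)) -> fin (\sum_(i <- r | Pr i) F i).
  move=> finF; apply: big_ind => //; exists (fun _ => 0).
  by rewrite big1 ?subr0 => [|i _]; [case: Ji | rewrite rmorph0 mul0r].
have finM a x : fin x -> fin (param_subst T a * x).
  move=> [b Jb]; exists (fun i => a * b i).
  have := is_idealM (param_subst T a) Ji Jb; rewrite mulrBr mulr_sumr; congr (J (_ - _)).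
  by apply: eq_bigr => i _; rewrite rmorphM mulrA.
have finZ c x : fin x -> fin (c *: x).
  by move=> /(finM c%:MP); rewrite /param_subst substC mul_mpolyC.
have fin_homog D x : (forall w : 'X_{1..N}, mdeg w = D -> fin 'X_[w]) -> x \is D.-homog -> fin x.
  move=> finw /dhomogP xD; rewrite [x]mpolyE big_seq.
  by apply: fin_sum => w /xD wD; apply/finZ/finw.
have fin_small w : (mdeg w < q.+1)%N -> fin 'X_[w].
  move=> w_lt; exists (fun i => (enum_val i == BMultinom w_lt)%:R).
  rewrite (bigD1 (enum_rank (BMultinom w_lt))) //= /gen_mon enum_rankK eqxx rmorph1 mul1r.
  rewrite big1 ?addr0 ?subrr; first by case: Ji.
  move=> i iw; suff /negbTE -> : enum_val i != BMultinom w_lt by rewrite rmorph0 mul0r.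
  by apply: contra iw => /eqP <-; rewrite enum_valK.
have finX D w : mdeg w = D -> fin 'X_[w].
  elim: D w => [|D IHD] w wD; first by apply: fin_small; rewrite wD.
  have [|w_ge] := ltnP (mdeg w) q.+1; first exact: fin_small.
  have [w1 [w2 [wE w1q]]] := split_mnm w_ge.
  have [g gq Jg] := JT w1 w1q.
  have -> : 'X_[w] = 'X_[w2] * ('X_[w1] - \sum_j lform T (wid j) * g j)
                     + \sum_j param_subst T 'X_j * (g j * 'X_[w2]).
    rewrite mulrBr wE mpolyXD [_ * 'X_[w1]]mulrC -addrA mulr_sumr -sumrN -big_split /=.
    rewrite big1 ?addr0 // => j _.
    by rewrite /param_subst substX mulrA mulrC addNr.
  apply: finD.
    exists (fun _ => 0); rewrite [X in _ - X]big1 ?subr0; first exact: (is_idealM _ Ji Jg).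
    by move=> i _; rewrite rmorph0 mul0r.
  apply: fin_sum => j _; apply: finM; apply: (fin_homog D) => //.
  have DE : (D = q + mdeg w2)%N.
    by apply/eqP; rewrite -eqSS -wD wE mdegD w1q addSn.
  by rewrite DE; apply: dhomogM => //; rewrite dhomogX.
by move=> x; rewrite -/(fin x) [x]mpolyE; apply: fin_sum => w _; apply/finZ/(finX (mdeg w)).
Qed.

(* If the matrix [T] of polynomials specializes at [c0] to a system of
   parameters, write each monomial of degree q + 1 as i_w + sum_j y_j(c0) g_(w,j)
   with i_w in J, and let G(c) be the coefficient matrix of the polynomials
   i_w + sum_j y_j(c) g_(w,j).  Then G(c0) = 1, and det G(c) != 0 suffices. *)
Lemma params_open J p (T : 'M[A p]_N) (c0 : 'I_p -> k) q :
  is_ideal J -> params J (map_mx (meval c0) T) q ->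
  exists2 F : A p, F.@[c0] != 0 &
    forall c, F.@[c] != 0 -> params J (map_mx (meval c) T) q.
Proof.
move=> Ji JT0.
pose W := {w : 'X_{1..N < q.+2} | mdeg w == q.+1}.
pose mon (w : W) : 'X_{1..N} := val (val w).
have monq w : mdeg (mon w) = q.+1 by apply/eqP/(valP w).
have mon_onto w : mdeg w = q.+1 -> exists w', mon w' = w.
  move=> wq; have w_lt : (mdeg w < q.+2)%N by rewrite wq.
  by exists (Sub (BMultinom w_lt) (introT eqP wq)).
have mon_inj : injective mon by move=> w w' /val_inj /val_inj.
have [g /= gP] : exists g : W -> 'I_delta -> A N, forall w,
    (forall j, g w j \is q.-homog) /\
    J ('X_[mon w] - \sum_j lform (map_mx (meval c0) T) (wid j) * g w j).
  apply: (fin_all_exists (P := fun w g => (forall j, g j \is q.-homog) /\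
    J ('X_[mon w] - \sum_j lform (map_mx (meval c0) T) (wid j) * g j))) => w.
  by have [g gq Jg] := JT0 _ (monq w); exists g.
pose iota w := 'X_[mon w] - \sum_j lform (map_mx (meval c0) T) (wid j) * g w j.
pose r c w := iota w + \sum_j lform (map_mx (meval c) T) (wid j) * g w j.
have r_homog c w : r c w \is q.+1.-homog.
  rewrite /r /iota; apply: rpredD; first apply: rpredB.
  - by rewrite dhomogX /= monq.
  - by apply: rpred_sum => j _; rewrite -add1n; apply: dhomogM; [apply: lform_homog | case: (gP w)].
  - by apply: rpred_sum => j _; rewrite -add1n; apply: dhomogM; [apply: lform_homog | case: (gP w)].
pose G : 'M[A p]_#|{: W}| := \matrix_(a, b)
  (((iota (enum_val a))@_(mon (enum_val b)))%:MP
   + \sum_j \sum_i ('X_i * g (enum_val a) j)@_(mon (enum_val b)) *: T (wid j) i).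
have GE c a b : (map_mx (meval c) G) a b = (r c (enum_val a))@_(mon (enum_val b)).
  rewrite !mxE mevalD mevalC raddf_sum [RHS]mcoeffD raddf_sum /=; congr (_ + _).
  apply: eq_bigr => j _; rewrite raddf_sum /lform mulr_suml raddf_sum /=.
  by apply: eq_bigr => i _; rewrite mevalZ mxE -scalerAl mcoeffZ mulrC.
exists (\det G).
  rewrite -det_map_mx (_ : map_mx _ _ = 1%:M) ?det1 ?oner_neq0 //.
  apply/matrixP => a b; rewrite GE /r /iota subrK mcoeffX !mxE.
  by rewrite (inj_eq mon_inj) (inj_eq enum_val_inj).
move=> c; rewrite -det_map_mx => detG w wq.
have [w' w'w] := mon_onto w wq.
pose H := invmx (map_mx (meval c) G).
have unitG : map_mx (meval c) G \in unitmx by rewrite unitmxE unitfE.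
pose a0 := enum_rank w'.
(* Inverting G(c) expresses the monomial through the forms [r c]. Both sides are homogeneous of
   degree q + 1, so only coefficients in that degree need comparing. *)
have XE : 'X_[w] = \sum_b H a0 b *: r c (enum_val b).
  apply/mpolyP => u; rewrite raddf_sum /=.
  have [uq|uq] := eqVneq (mdeg u) q.+1; last first.
    rewrite mcoeffX (negbTE (_ : w != u)); last by apply: contraNneq uq => <-; rewrite wq.
    rewrite big1 // => b _; rewrite mcoeffZ (_ : (r _ _)@_u = 0) ?mulr0 //.
    exact: dhomog_nemf_coeff (r_homog _ _) uq.
  have [u' <-] := mon_onto u uq.
  have /matrixP/(_ a0 (enum_rank u')) : H *m map_mx (meval c) G = 1%:M by rewrite mulVmx.
  rewrite !mxE (inj_eq enum_rank_inj) mcoeffX -w'w (inj_eq mon_inj) => <-.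
  by apply: eq_bigr => b _; rewrite GE enum_rankK mcoeffZ.
exists (fun j => \sum_b H a0 b *: g (enum_val b) j).
  by move=> j; apply: rpred_sum => b _; apply: rpredZ; case: (gP (enum_val b)).
suff -> : 'X_[w] - \sum_j lform (map_mx (meval c) T) (wid j) * (\sum_b H a0 b *: g (enum_val b) j)
    = \sum_b (H a0 b)%:MP * iota (enum_val b).
  by apply: is_ideal_sum => // b _; apply: is_idealM => //; case: (gP (enum_val b)).
rewrite XE; apply/eqP; rewrite subr_eq; apply/eqP.
under [X in _ + X]eq_bigr => j _ do rewrite mulr_sumr.
rewrite exchange_big -big_split; apply: eq_bigr => b _ /=.
rewrite /r scalerDr mul_mpolyC scaler_sumr; congr (_ + _).
by apply: eq_bigr => j _; rewrite scalerAr.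
Qed.

End Delta.

End HomogeneousSystems.

Section Homogeneous.
Variables (k : fieldType) (N : nat).
Local Notation A n := {mpoly k[n]}.
Implicit Types (J : A N -> Prop).

Lemma pihomogM t d (a G : A N) : G \is t.-homog ->
  pihomog mdeg (t + d) (a * G) = pihomog mdeg d a * G.
Proof.
move=> Gt; rewrite [a]mpolyE mulr_suml !raddf_sum mulr_suml; apply: eq_bigr => m _ /=.
rewrite -scalerAl !linearZ /= -scalerAl; congr (_ *: _); rewrite pihomogX.
have XG : 'X_[m] * G \is (mdeg m + t).-homog by apply: dhomogM => //; rewrite dhomogX.
case: eqP => [md|md]; first by rewrite pihomog_dE // addnC -md.
by rewrite mul0r; apply: (pihomog_ne0 _ XG); rewrite addnC eqn_add2l; apply/eqP.
Qed.

Lemma pihomogM_small t d (a G : A N) : G \is t.-homog -> (d < t)%N ->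
  pihomog mdeg d (a * G) = 0.
Proof.
move=> Gt dt; rewrite [a]mpolyE mulr_suml !raddf_sum; apply: big1 => m _ /=.
rewrite -scalerAl !linearZ /=.
have XG : 'X_[m] * G \is (mdeg m + t).-homog by apply: dhomogM => //; rewrite dhomogX.
rewrite (pihomog_ne0 _ XG) ?scaler0 //.
by apply: contraTneq dt => <-; rewrite -leqNgt leq_addl.
Qed.

Lemma ideal_gen_homog (S : A N -> Prop) t : (forall x, S x -> x \is t.-homog) ->
  forall d x, ideal_gen S x -> ideal_gen S (pihomog mdeg d x).
Proof.
move=> St d x [s sS ->]; rewrite raddf_sum big_seq /=.
apply: is_ideal_sum => [|p /sS Sp]; first exact: ideal_gen_is_ideal.
have [td|dt] := leqP t d.
  rewrite -(subnKC td) pihomogM; last exact: St.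
  by apply: is_idealM; [exact: ideal_gen_is_ideal | exact: mem_ideal_gen].
by rewrite (pihomogM_small _ (St _ Sp)) //; case: (ideal_gen_is_ideal S).
Qed.

Variables (delta : nat) (le_dN : (delta <= N)%N).
Local Notation wid := (widen_ord le_dN).

(** If no power of a variable were in J plus the forms, a prime over this ideal would avoid the
    powers of the variable. So each variable has such a power, and so do all monomials of large
    degree. *)
Lemma params_of_primes J (T : 'M[k]_N) :
  is_ideal J -> (forall d x, J x -> J (pihomog mdeg d x)) ->
  (forall P : {pred A N}, is_prime_ideal P -> (forall x, J x -> x \in P) ->
     (forall j, lform T (wid j) \in P) -> forall i, 'X_i \in P) ->
  exists q, params le_dN J T q.
Proof.
move=> Ji Jhom JT.
pose J' x := exists g : 'I_delta -> A N, J (x - \sum_j lform T (wid j) * g j).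
have JJ' x : J x -> J' x.
  by move=> Jx; exists (fun _ => 0); rewrite big1 ?subr0 // => j _; rewrite mulr0.
have J'i : is_ideal J'.
  split; first by apply: JJ'; case: Ji.
  move=> a x y [g Jg] [h Jh]; exists (fun j => a * g j + h j).
  have := Ji.2 a _ _ Jg Jh; rewrite mulrBr addrACA -opprD mulr_sumr -big_split.
  by congr (J (_ - _)); apply: eq_bigr => j _; rewrite mulrDr mulrCA.
have J'y j : J' (lform T (wid j)).
  exists (fun l => (l == j)%:R); rewrite (bigD1 j) //= eqxx mulr1 big1 ?addr0 ?subrr.
    by case: Ji.
  by move=> l /negbTE ->; rewrite mulr0.
have powJ' i : exists r, J' ('X_i ^+ r).
  apply: boolp.contrapT => nJ'.
  have [|||P [Pp J'P nP]] := @prime_avoiding _ J' (fun x => exists r, x = 'X_i ^+ r) J'i.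
  - by exists 0%N.
  - by move=> _ _ [r ->] [s ->]; exists (r + s)%N; rewrite exprD.
  - by move=> x J'x [r xE]; apply: nJ'; exists r; rewrite -xE.
  apply: (nP 'X_i); last by exists 1%N.
  apply: JT => // [x Jx|j]; first exact/J'P/JJ'.
  exact: J'P.
have [r J'r] : exists r : 'I_N -> nat, forall i, J' ('X_i ^+ r i).
  exact: (fin_all_exists (P := fun i r => J' ('X_i ^+ r))).
(* A monomial of degree exceeding the sum of the r_i has some exponent at least r_i. *)
exists (\sum_i r i)%N => w wq.
have [i wi] : exists i, (r i <= w i)%N.
  apply/existsP; apply: contraT; rewrite negb_exists => /forallP wr.
  have : (mdeg w <= \sum_i r i)%N.
    by rewrite mdegE; apply: leq_sum => i _; apply: ltnW; rewrite ltnNge.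
  by rewrite wq ltnn.
have [g Jg] : J' 'X_[w].
  have -> : w = (w - U_(i) *+ r i + U_(i) *+ r i)%MM.
    apply/mnmP => l; rewrite mnmDE mnmBE mulmnE mnm1E.
    by case: eqP => [<-|_]; rewrite ?mul1n ?subnK // mul0n subn0 addn0.
  by rewrite mpolyXD; apply: is_idealM => //; rewrite -mpolyXn.
(* J is homogeneous, so the cofactors may be replaced by their components of the right degree. *)
exists (fun j => pihomog mdeg (\sum_i r i) (g j)); first by move=> j; apply: pihomogP.
have pi_sum (d : nat) (F : 'I_delta -> A N) :
    pihomog mdeg d (\sum_j F j) = \sum_j pihomog mdeg d (F j) by rewrite raddf_sum.
have := Jhom (\sum_i r i).+1 _ Jg; rewrite raddfB /= pi_sum; congr (J (_ - _)).
  by rewrite pihomog_dE // dhomogX /= wq.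
apply: eq_bigr => j _; rewrite mulrC -add1n pihomogM ?lform_homog //; exact: mulrC.
Qed.

End Homogeneous.

(** * Vandermonde combinations along diagonals *)

Lemma increasing_enum p t (R : {set 'I_p}) : (t <= #|R|)%N ->
  exists2 f : 'I_t -> 'I_p, forall i, f i \in R & forall i j : 'I_t, (i < j)%N -> (f i < f j)%N.
Proof.
move=> tR; have R_sorted : sorted (relpre (@nat_of_ord p) ltn) (enum R).
  rewrite /enum_mem; apply: sorted_filter; first by move=> a b c; apply: ltn_trans.
  by rewrite -enumT -sorted_map val_enum_ord iota_ltn_sorted.
case: t tR => [|t] tR; first by have f0 : 'I_0 -> 'I_p by [case]; exists f0; case.
have /set0Pn[x0 _] : R != set0 by rewrite -card_gt0 (leq_trans _ tR).
have ltR (i : 'I_t.+1) : (i < size (enum R))%N by rewrite -cardE (leq_trans (ltn_ord i)).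
exists (fun i : 'I_t.+1 => nth x0 (enum R) i); first by move=> i; rewrite -mem_enum mem_nth.
move=> i j ij; apply: (sorted_ltn_nth _ x0 R_sorted) => //; last exact: ltR.
  by move=> a b c; apply: ltn_trans.
exact: ltR.
Qed.

Lemma perm_initial n (G : {set 'I_n}) :
  exists s : 'S_n, forall j, (s j \in G) = (j < #|G|)%N.
Proof.
pose l := enum G ++ enum (~: G).
have sz_l : size l = n by rewrite size_cat -!cardE cardsC card_ord.
have ul : uniq l.
  rewrite cat_uniq !enum_uniq /= andbT; apply/hasPn => x.
  by rewrite !mem_enum inE.
have f_inj : injective (fun j : 'I_n => nth j l j).
  move=> i j; rewrite (set_nth_default i j) ?sz_l // => /eqP.
  by rewrite nth_uniq ?sz_l // => /eqP /val_inj.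
exists (perm f_inj) => j; rewrite permE nth_cat -cardE; case: ltnP => jG.
  by rewrite -mem_enum mem_nth // -cardE.
have : nth j (enum (~: G)) (j - #|G|) \in ~: G.
  rewrite -mem_enum mem_nth // -cardE -(ltn_add2l #|G|) subnKC //.
  by rewrite cardsC card_ord.
by rewrite inE => /negbTE.
Qed.

Section Cells.
Variables (p q : nat).
Local Notation cell := ('I_p * 'I_q)%type.

Definition idx (u : cell) : 'I_(p * q) := mxvec_index u.1 u.2.
Definition cell_of (x : 'I_(p * q)) : cell := enum_val (cast_ord (esym (mxvec_cast p q)) x).

Lemma idxK : cancel idx cell_of.
Proof. by case=> i j; rewrite /cell_of /idx cast_ordK enum_rankK. Qed.

Lemma mxvec_indexK i j : cell_of (mxvec_index i j) = (i, j).
Proof. exact: (idxK (i, j)). Qed.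

Lemma cell_ofK : cancel cell_of idx.
Proof.
move=> x; rewrite /cell_of /idx /mxvec_index -surjective_pairing enum_valK.
exact: cast_ordKV.
Qed.

(** The place of u on its diagonal, counted from the upper left end. *)
Definition pos (u : cell) : nat := minn u.1 u.2.
Definition same_diag (u v : cell) : bool := (u.1 + v.2 == v.1 + u.2)%N.

Lemma pos_inj (u v : cell) : same_diag u v -> pos u = pos v -> u = v.
Proof.
case: u v => [i j] [i' j']; rewrite /same_diag /pos /= => /eqP d e.
by congr (_, _); apply: val_inj => /=; lia.
Qed.

(** Since [pos] is injective on a diagonal, some cell of B has position at least e; moving up the
    diagonal from it reaches position e. *)
Lemma cell_on_diag (u0 : cell) (B : {set cell}) e :
  (forall v, v \in B -> same_diag v u0) -> (e < #|B|)%N ->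
  exists2 u, same_diag u u0 & pos u = e.
Proof.
move=> Bd eB.
have [v vB ev] : exists2 v, v \in B & (e <= pos v)%N.
  apply/exists_inP; apply: contraLR eB; rewrite -leqNgt negb_exists_in.
  move=> /forall_inP Be; rewrite -[e in (_ <= e)%N](size_iota 0) cardE.
  rewrite -(size_map pos); apply: uniq_leq_size.
    rewrite map_inj_in_uniq ?enum_uniq // => u v; rewrite !mem_enum => uB vB.
    by apply: pos_inj; have := Bd _ uB; have := Bd _ vB; rewrite /same_diag; lia.
  move=> x /mapP[v]; rewrite mem_enum => /Be; rewrite -ltnNge => ve ->.
  by rewrite mem_iota.
have := Bd _ vB; case: v vB ev => [i j] vB; rewrite /pos /same_diag /= => ev d.
have i_lt : (i - (minn i j - e) < p)%N by apply: leq_ltn_trans (leq_subr _ _) (ltn_ord i).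
have j_lt : (j - (minn i j - e) < q)%N by apply: leq_ltn_trans (leq_subr _ _) (ltn_ord j).
by exists (Ordinal i_lt, Ordinal j_lt); rewrite /=; lia.
Qed.

Section Diagonals.
Variables (k : fieldType) (a : nat -> k).
Hypothesis a_inj : {in gtn p &, injective a}.

(* Row u holds the moments of order pos u of the diagonal through u. *)
Definition diag_moments : 'M[k]_(p * q) := \matrix_(x, y)
  (if same_diag (cell_of x) (cell_of y) then a (pos (cell_of y)) ^+ pos (cell_of x) else 0).

(** The diagonal has a cell at each position below the size of B, so the moments that Vandermonde
    requires for B all occur among the rows. *)
Lemma moments_zero (D : comNzRingType) (f : {rmorphism k -> D}) (z : cell -> D)
    (u0 : cell) (B : {set cell}) :
  (forall u, u \in B -> same_diag u u0) ->
  (forall u, same_diag u u0 -> u \notin B -> z u = 0) ->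
  (forall u, same_diag u u0 -> (pos u < #|B|)%N ->
     \sum_v f (diag_moments (idx u) (idx v)) * z v = 0) ->
  forall u, u \in B -> z u = 0.
Proof.
move=> Bd zB mom; apply: (vandermonde_zero (f := f) (a := fun u => a (pos u))).
  move=> u v uB vB /a_inj; rewrite !inE !gtn_min !ltn_ord => /(_ isT isT).
  by apply: pos_inj; have := Bd _ uB; have := Bd _ vB; rewrite /same_diag; lia.
move=> e eB; have [u uu0 ue] := cell_on_diag Bd eB.
rewrite -[RHS](mom u) ?ue // [RHS](bigID (mem B)) /= [X in _ = _ + X]big1 ?addr0.
  apply: eq_bigr => v vB; rewrite mxE !idxK ue.
  suff -> : same_diag u v by [].
  by have := Bd _ vB; move: uu0; rewrite /same_diag; lia.
move=> v vB; rewrite mxE !idxK; case: ifP => [uv|]; last by rewrite rmorph0 mul0r.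
rewrite zB ?mulr0 //.
by move: uv uu0; rewrite /same_diag; lia.
Qed.

(** On each diagonal the matrix restricts to a square Vandermonde matrix. *)
Lemma diag_moments_unit : diag_moments \in unitmx.
Proof.
rewrite -unitmx_tr -row_free_unit -kermx_eq0; apply/rowV0P => w /sub_kermxP wM.
apply/rowP => x; rewrite mxE -[x]cell_ofK; set u0 := cell_of x.
apply: (@moments_zero _ idfun (fun v => w 0 (idx v)) u0 [set u | same_diag u u0]).
- by move=> u; rewrite inE.
- by move=> u uu0; rewrite inE uu0.
- move=> u _ _; have /rowP/(_ (idx u)) := wM; rewrite !mxE => wMu.
  rewrite -[RHS]wMu (reindex idx); last by exists cell_of => y _; rewrite ?idxK ?cell_ofK.
  by apply: eq_bigr => v _; rewrite !mxE mulrC.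
- by rewrite inE /same_diag addnC.
Qed.

Lemma zero_of_minors_moments (D : idomainType) (f : {rmorphism k -> D}) (z : cell -> D) r :
  (forall (g : 'I_r.+1 -> 'I_p) (h : 'I_r.+1 -> 'I_q),
     (forall i j : 'I_r.+1, (i < j)%N -> (g i < g j)%N) ->
     (forall i j : 'I_r.+1, (i < j)%N -> (h i < h j)%N) ->
     \det (\matrix_(i, j) z (g i, h j)) = 0) ->
  (forall u : cell, (pos u < r)%N -> \sum_v f (diag_moments (idx u) (idx v)) * z v = 0) ->
  forall u, z u = 0.
Proof.
move=> minors moments u.
(* Induction over the diagonals, from the top right corner to the bottom left one. *)
have [m um] := ubnP (u.1 + (q - u.2)).
elim: m u um => // m IHm u0 um.
pose B := [set u | same_diag u u0 & z u != 0].
have Bd u : u \in B -> same_diag u u0 by rewrite inE => /andP[].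
have B_small : (#|B| <= r)%N.
  rewrite leqNgt; apply/negP => rB.
  have card_rows : #|[set u.1 | u in B]| = #|B|.
    apply: card_in_imset => u v uB vB uv.
    case: u v uB vB uv => [i j] [i' j'] /Bd d /Bd d' /= ii'.
    by congr (_, _) => //; apply: val_inj; move: d d'; rewrite /same_diag /= ii'; lia.
  have [g gB g_incr] : exists2 g : 'I_r.+1 -> 'I_p, forall i, g i \in [set u.1 | u in B]
      & forall i j : 'I_r.+1, (i < j)%N -> (g i < g j)%N.
    by apply: increasing_enum; rewrite card_rows.
  have [h hB] : exists h : 'I_r.+1 -> 'I_q, forall i, (g i, h i) \in B.
    apply: (fin_all_exists (P := fun i j => (g i, j) \in B)) => i.
    by have /imsetP[[i' j] ijB ->] := gB i; exists j.
  have h_incr (i j : 'I_r.+1) : (i < j)%N -> (h i < h j)%N.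
    move=> /g_incr; have := Bd _ (hB i); have := Bd _ (hB j).
    by rewrite /same_diag /=; lia.
  (* The entries above the diagonal of this minor lie on earlier diagonals of the matrix and vanish,
     so the minor is a product of nonzero entries. *)
  have := minors g h g_incr h_incr; rewrite det_trig; last first.
    apply/is_trig_mxP => i j ij; rewrite mxE; apply: IHm => /=.
    have := Bd _ (hB j); rewrite /same_diag /=; have := g_incr _ _ ij.
    by move: um (ltn_ord u0.2) (ltn_ord (h j)); lia.
  apply/eqP/prodf_neq0 => i _; rewrite mxE.
  by have := hB i; rewrite inE => /andP[].
apply/eqP; apply: contraT => zu0.
have u0B : u0 \in B by rewrite inE zu0 /same_diag addnC andbT eqxx.
suff z0 : z u0 = 0 by rewrite z0 eqxx in zu0.
apply: (moments_zero (f := f) Bd) u0B => u uu0; first by rewrite inE uu0 => /negPn /eqP.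
by move=> uB; apply: moments; apply: leq_trans uB B_small.
Qed.

End Diagonals.
End Cells.

(** * Minors of the generic matrix *)

(** Padding X with a zero column and Y with a zero row gives square matrices with the same product,
    the first of determinant zero. *)
Lemma det_mulmx_small (R : comNzRingType) r (X : 'M[R]_(r.+1, r)) (Y : 'M[R]_(r, r.+1)) :
  \det (X *m Y) = 0.
Proof.
pose X' : 'M[R]_r.+1 := row_mx (0 : 'cV_r.+1) X.
pose Y' : 'M[R]_r.+1 := col_mx (0 : 'rV_r.+1) Y.
have -> : X *m Y = X' *m Y' by rewrite (@mul_row_col _ r.+1 1 r) mul0mx add0r.
rewrite det_mulmx (expand_det_col X' ord0) big1 ?mul0r // => i _.
rewrite /X' mxE; case: splitP => j //.
by rewrite mxE mul0r.
Qed.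

Lemma card_ord_ge n r : #|[set i : 'I_n | (r <= i)%N]| = (n - r)%N.
Proof.
rewrite -sum1_card (eq_bigl (fun i : 'I_n => (r <= i)%N)) => [|i]; last by rewrite inE.
by rewrite -(big_geq_mkord _ _ predT (fun _ => 1%N)) sum_nat_const_nat muln1.
Qed.

Section GenericMatrix.
Variables (k : fieldType) (p q r : nat).
Local Notation A n := {mpoly k[n]}.
Local Notation N := (p * q)%N.
Local Notation Z := (\matrix_(i < p, j < q) 'X_(mxvec_index i j) : 'M[A N]_(p, q)).
Local Notation minorsZ := (@minors_ideal (A N) p q r.+1 Z).

Lemma minor_homog x : is_minor r.+1 Z x -> x \is r.+1.-homog.
Proof.
move=> [f [g [_ _ ->]]]; apply: rpred_sum => s _; rewrite rpredMsign.
set y := \prod_i _; suff : y \is (\sum_(i < r.+1) 1).-homog by rewrite sum1_card card_ord.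
rewrite /y.
apply: (big_ind2 (fun (x : A N) c => x \is c.-homog)) => [|x1 c x2 d|i _].
- exact: dhomog1.
- exact: dhomogM.
- by rewrite !mxE dhomogX /= mdeg1.
Qed.

Lemma minorsZ_ideal : is_ideal minorsZ.
Proof. exact: ideal_gen_is_ideal. Qed.

(** The set Gamma, with r = t - 1. *)
Definition low_cells : {set 'I_N} := [set idx u | u in [set u | (pos u < r)%N]].

Lemma card_low_cells : #|low_cells| = (p * q - (p - r) * (q - r))%N.
Proof.
rewrite card_imset; last exact: (can_inj (@idxK p q)).
have <- : #|setX [set i : 'I_p | (r <= i)%N] [set j : 'I_q | (r <= j)%N]| = ((p - r) * (q - r))%N.
  by rewrite cardsX !card_ord_ge.
set S := [set u | _]; set W := setX _ _; have -> : W = ~: S.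
  by apply/setP => -[i j]; rewrite !inE /pos /=; lia.
have <- : (#|S| + #|~: S| = p * q)%N by rewrite cardsC card_prod !card_ord.
by rewrite addnK.
Qed.

(** The number delta: the dimension of the variety of p x q matrices of rank at most r, when r is at
    most p and q. *)
Definition rank_dim : nat := (p * q - (p - r) * (q - r))%N.
Definition rank_dim_le : (rank_dim <= N)%N := leq_subr _ _.

Hypothesis k_inf : infinite_type k.

Lemma minorsZ_params :
  exists2 T : 'M[k]_N, T \in unitmx & exists d, params rank_dim_le minorsZ T d.
Proof.
have [sq us sz] := infinite_uniq_seq k_inf p.
pose a e := nth 0 sq e.
have a_inj : {in gtn p &, injective a}.
  move=> e e'; rewrite !inE => ep e'p /eqP; rewrite nth_uniq ?sz // => /eqP; exact.
(* The rows are reordered so that the moments of order below r come first. *)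
have [s sP] := perm_initial low_cells.
pose T := row_perm s (diag_moments p q a).
exists T; first by rewrite /T row_permE unitmx_mul unitmx_perm diag_moments_unit.
apply: params_of_primes; first exact: minorsZ_ideal.
  by move=> d x; apply: ideal_gen_homog minor_homog d x.
move=> P Pp minorsP lformP x.
have [D [f fP]] := prime_quotient Pp.
pose z u := f 'X_(idx u).
suff /(_ (cell_of x)) : forall u, z u = 0 by rewrite /z cell_ofK fP => ->.
apply: (zero_of_minors_moments a_inj (f := f \o @mpolyC N k) (r := r)).
  move=> g h g_incr h_incr; apply/eqP.
  rewrite (_ : (\matrix_(i, j) z (g i, h j)) = map_mx f (mxsub g h Z)).
    rewrite det_map_mx -fP; apply/minorsP/mem_ideal_gen.
    by exists g, h.
  by apply/matrixP => i j; rewrite !mxE.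
move=> u ur; have idx_low : idx u \in low_cells by apply: imset_f; rewrite inE.
have s_lt : (s^-1%g (idx u) < rank_dim)%N.
  by rewrite /rank_dim -card_low_cells -sP permKV.
transitivity (f (lform T (widen_ord rank_dim_le (Ordinal s_lt)))); last first.
  by apply/eqP; rewrite -fP.
rewrite rmorph_sum [RHS](reindex (@idx p q)); last first.
  by exists (@cell_of p q) => y _; rewrite ?idxK ?cell_ofK.
have sE : s (widen_ord rank_dim_le (Ordinal s_lt)) = idx u.
  by rewrite -[RHS](permKV s); congr (s _); apply: val_inj.
by apply: eq_bigr => v _; rewrite -mul_mpolyC rmorphM /= [T _ _]mxE sE.
Qed.

Hypotheses (rp : (r <= p)%N) (rq : (r <= q)%N).

(* The kernel of Z |-> A B, the generic matrix of rank at most r. *)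
Lemma minorsZ_prime : exists K : {pred A N},
  [/\ is_prime_ideal K, forall x, minorsZ x -> x \in K
    & exists w : 'I_rank_dim -> A N, alg_indep_mod w (fun x => x \in K)].
Proof.
pose X : 'M[A (p * r + r * q)]_(p, r) := \matrix_(i, l) 'X_(lshift _ (mxvec_index i l)).
pose Y : 'M[A (p * r + r * q)]_(r, q) := \matrix_(l, j) 'X_(rshift _ (mxvec_index l j)).
pose h x := (X *m Y) (cell_of x).1 (cell_of x).2.
pose mu : {rmorphism A N -> A (p * r + r * q)} := subst h.
exists ([pred x | mu x == 0] : {pred A N}); split; first exact: kernel_prime.
  apply: ideal_gen_min.
    exact/is_prime_ideal_is_ideal/kernel_prime.
  move=> _ [f [g [_ _ ->]]]; rewrite inE -det_map_mx.
  rewrite (_ : map_mx _ _ = rowsub f X *m colsub g Y) ?det_mulmx_small //.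
  apply/matrixP => i j; rewrite !mxE /mu /= substX /h -[mxvec_index _ _]/(idx (f i, g j)) idxK mxE.
  by apply: eq_bigr => l _; rewrite !mxE.
have [s sP] := perm_initial low_cells.
pose gam (i : 'I_rank_dim) := s (widen_ord rank_dim_le i).
have gam_low i : (pos (cell_of (gam i)) < r)%N.
  have : gam i \in low_cells by rewrite sP card_low_cells; exact: (ltn_ord i).
  by move=> /imsetP[u]; rewrite inE => ur ->; rewrite idxK.
exists (fun i => 'X_(gam i)) => F /eqP F0; apply: contra_eq F0 => F_neq0.
pose F' : A N := subst (fun i => 'X_(gam i)) F.
have F'_neq0 : F' != 0.
  have [v0 Fv0] := mpoly_neq0_point k_inf F_neq0.
  pose v x := oapp v0 0 (insub (val (s^-1%g x))).
  have : F'.@[v] != 0.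
    rewrite meval_subst (meval_eq (v2 := v0)) // => i.
    rewrite mevalXU /v permK /= insubT //= => lt_i.
    by congr v0; apply: val_inj.
  by apply: contra_neq => ->; rewrite meval0.
pose M0 : 'M[A N]_r := \matrix_(i, j) 'X_(idx (widen_ord rp i, widen_ord rq j)).
have M0_neq0 : \det M0 != 0.
  pose v (x : 'I_N) : k := ((cell_of x).1 == (cell_of x).2 :> nat)%:R.
  have : (\det M0).@[v] != 0.
    rewrite -det_map_mx (_ : map_mx _ _ = 1%:M) ?det1 ?oner_neq0 //.
    by apply/matrixP => i j; rewrite !mxE /= mevalXU /v idxK.
  by apply: contra_neq => ->; rewrite meval0.
(* Take a matrix v at which neither F' nor the top left r x r minor vanishes. *)
have [v] := mpoly_neq0_point k_inf (mulf_neq0 F'_neq0 M0_neq0).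
rewrite mevalM mulf_eq0 negb_or => /andP[Fv]; rewrite -det_map_mx => Mv.
pose U := map_mx (meval v) M0.
have U_unit : U \in unitmx by rewrite unitmxE unitfE.
(* With b the first r rows of v and a its first r columns times the inverse of U, the product a b
   has the first r rows and columns of v, hence agrees with v on Gamma. *)
pose b : 'M[k]_(r, q) := \matrix_(l, j) v (idx (widen_ord rp l, j)).
pose a : 'M[k]_(p, r) := (\matrix_(i, l) v (idx (i, widen_ord rq l))) *m invmx U.
have abE (u : 'I_p * 'I_q) : (pos u < r)%N -> (a *m b) u.1 u.2 = v (idx u).
  case: u => i j; rewrite /pos gtn_min /= => /orP[ir|jr].
    have aE : row i a = row (Ordinal ir) 1%:M.
      rewrite -(mulmxV U_unit) !row_mul; congr (_ *m _).
      by apply/rowP => l; rewrite !mxE /= mevalXU; congr (v (idx (_, _))); apply: val_inj.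
    have /rowP/(_ j) : row i (a *m b) = row (Ordinal ir) b.
      by rewrite row_mul aE -row_mul mul1mx.
    by rewrite !mxE => ->; congr (v (idx (_, _))); apply: val_inj.
  have bE : col j b = col (Ordinal jr) U.
    by apply/colP => l; rewrite !mxE /= mevalXU; congr (v (idx (_, _))); apply: val_inj.
  have /colP/(_ i) : col j (a *m b) = col (Ordinal jr) (a *m U).
    by rewrite !colE -!mulmxA -!colE bE.
  by rewrite mulmxKV // !mxE => ->; congr (v (idx (_, _))); apply: val_inj.
(* At the point c given by a and b, [mu F'] takes the nonzero value of F' at v. *)
pose c (x : 'I_(p * r + r * q)) := match split x with
  | inl y => a (cell_of y).1 (cell_of y).2 | inr y => b (cell_of y).1 (cell_of y).2 end.
apply: contra_neq Fv => F0.
have : (mu F').@[c] = 0 by rewrite /F' F0 meval0.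
rewrite !meval_subst => <-; apply: meval_eq => i.
rewrite !mevalXU /h -[in LHS](cell_ofK (gam i)) -(abE _ (gam_low i)) [(a *m b) _ _]mxE.
rewrite [(X *m Y) _ _]mxE rmorph_sum; apply: eq_bigr => l _.
rewrite rmorphM [X _ _]mxE [Y _ _]mxE /= !mevalXU /c.
rewrite -[lshift _ _]/(unsplit (inl _)) -[rshift _ _]/(unsplit (inr _)) !unsplitK.
by rewrite !mxvec_indexK.
Qed.

End GenericMatrix.

(** * Linear changes of coordinates and linear sections *)

Section Coordinates.
Variables (k : fieldType).
Local Notation A n := {mpoly k[n]}.

Lemma rmorph_congr n (R : comNzRingType) (J : R -> Prop) (f g : {rmorphism A n -> R}) :
  is_ideal J -> (forall c, f c%:MP = g c%:MP) -> (forall i, J (f 'X_i - g 'X_i)) ->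
  forall x, J (f x - g x).
Proof.
move=> Ji fgC fgX x; have J0 : J 0 by case: Ji.
have JM a b c d : J (a - b) -> J (c - d) -> J (a * c - b * d).
  move=> Jab Jcd; have -> : a * c - b * d = c * (a - b) + b * (c - d).
    by rewrite !mulrBr ![c * _]mulrC addrA subrK.
  by apply: is_idealD => //; apply: is_idealM.
rewrite [x]mpolyE !rmorph_sum -sumrB; apply: is_ideal_sum => // m _.
rewrite -mul_mpolyC !rmorphM fgC -mulrBr; apply: is_idealM => //.
rewrite mpolyXE_id !rmorph_prod.
apply: (big_ind2 (fun a b => J (a - b))) => [|a b c d|i _]; rewrite ?subrr //; first exact: JM.
rewrite !rmorphXn; elim: (m i) => [|e IHe]; first by rewrite !expr0 subrr.
by rewrite !exprS; apply: JM.
Qed.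

(* X_i is sent to X_(i - s), and to 0 when i - s is not an index in [0, b). *)
Definition shiftX a b s (i : 'I_a) : A b :=
  if (s <= i)%N then oapp (fun l : 'I_b => 'X_l) 0 (insub (i - s)%N) else 0.

Lemma shiftX_lt a b s (i : 'I_a) : (i < s)%N -> shiftX b s i = 0.
Proof. by move=> lt_is; rewrite /shiftX leqNgt lt_is. Qed.

Lemma shiftX_add a b s (i : 'I_a) (l : 'I_b) : i = (s + l)%N :> nat -> shiftX b s i = 'X_l.
Proof.
by move=> il; rewrite /shiftX il leq_addr addKn valK.
Qed.

Lemma incl_inj d n (le_dn : (d <= n)%N) : injective (@incl k n d le_dn).
Proof.
apply: (can_inj (g := subst (@shiftX n d 0))) => x.
apply: (mpoly_rmorph_ext (f := subst (@shiftX n d 0) \o incl le_dn) (g := idfun)) x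
  => [c|i] /=; first by rewrite /incl !substC.
by rewrite /incl !substX (shiftX_add (l := i)).
Qed.

Variables (N : nat).

Definition lsubst (T : 'M[k]_N) : A N -> A N := subst (lform T).
HB.instance Definition _ T := GRing.RMorphism.copy (lsubst T) (subst (lform T)).

Lemma lsubstX T i : lsubst T 'X_i = lform T i.
Proof. exact: substX. Qed.

Lemma lsubstC T c : lsubst T c%:MP = c%:MP.
Proof. exact: substC. Qed.

Lemma lsubstK T : T \in unitmx -> cancel (lsubst (invmx T)) (lsubst T).
Proof.
move=> T_unit x; apply: (mpoly_rmorph_ext (f := lsubst T \o lsubst (invmx T)) (g := idfun)) x
  => [c|i] /=; first by rewrite !lsubstC.
rewrite lsubstX /lform rmorph_sum /=.
transitivity (\sum_l (invmx T *m T) i l *: ('X_l : A N)).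
  under eq_bigr => j _ do
    rewrite -mul_mpolyC rmorphM /= lsubstC lsubstX mul_mpolyC /lform scaler_sumr.
  rewrite exchange_big; apply: eq_bigr => l _; rewrite mxE scaler_suml.
  by apply: eq_bigr => j _; rewrite scalerA.
rewrite mulVmx // (bigD1 i) //= mxE eqxx scale1r big1 ?addr0 // => l li.
by rewrite mxE eq_sym (negbTE li) scale0r.
Qed.

Lemma lsubstVK T : T \in unitmx -> cancel (lsubst T) (lsubst (invmx T)).
Proof. by move=> T_unit; rewrite -{1}[T]invmxK; apply: lsubstK; rewrite unitmx_inv. Qed.

Lemma lsubst_bij T : T \in unitmx -> bijective (lsubst T).
Proof. by move=> T_unit; exists (lsubst (invmx T)); [apply: lsubstVK | apply: lsubstK]. Qed.

Definition kill (s : nat) : A N -> A N := subst (fun i : 'I_N => if (i < s)%N then 0 else 'X_i).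
HB.instance Definition _ s :=
  GRing.RMorphism.copy (kill s) (subst (fun i : 'I_N => if (i < s)%N then 0 else 'X_i)).

(** In the coordinates given by T, the ideal of the first s forms is the kernel of setting s
    variables to zero. This gives a membership test valued in a domain. *)
Lemma ideal_lformsP (T : 'M[k]_N) (S : A N -> Prop) s : T \in unitmx ->
  (forall y, S y <-> exists2 j : 'I_N, (j < s)%N & y = lform T j) ->
  forall x, ideal_gen S x <-> kill s (lsubst (invmx T) x) = 0.
Proof.
move=> T_unit SP x; split=> [Sx|kx].
  apply/eqP; pose K := [pred x | (kill s \o lsubst (invmx T)) x == 0].
  have Ki := is_prime_ideal_is_ideal (kernel_prime (kill s \o lsubst (invmx T))).
  apply: (ideal_gen_min Ki _ Sx) => _ /SP[j js ->].
  by rewrite inE /= -lsubstX lsubstVK // /kill substX js.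
have Si := ideal_gen_is_ideal S.
have := @rmorph_congr _ _ _ (lsubst T) (lsubst T \o kill s) Si _ _ (lsubst (invmx T) x).
rewrite /= kx rmorph0 subr0 lsubstK //; apply=> [c|j]; first by rewrite /kill substC.
rewrite /kill substX; case: ifP => js; last by rewrite subrr; case: Si.
by rewrite rmorph0 subr0 lsubstX; apply/mem_ideal_gen/SP; exists j.
Qed.

End Coordinates.

Section LinearSection.
Variables (k : fieldType) (N n s : nat) (le_sN : (s <= N)%N) (sn : (s + n)%N = N).
Local Notation A n := {mpoly k[n]}.

Variables (T : 'M[k]_N) (c : 'M[k]_(s, N)).
Hypotheses (T_unit : T \in unitmx) (Tc : forall i j, T (widen_ord le_sN i) j = c i j).

Lemma lform_rows i : lform c i = lform T (widen_ord le_sN i).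
Proof. by apply: eq_bigr => j _; rewrite Tc. Qed.

Lemma lform_rowsP y :
  (exists i, y = lform c i) <-> exists2 j : 'I_N, (j < s)%N & y = lform T j.
Proof.
split=> [[i ->]|[j js ->]]; first by exists (widen_ord le_sN i); rewrite ?lform_rows /=.
by exists (Ordinal js); rewrite lform_rows; congr lform; apply: val_inj.
Qed.

(** Modulo the first i forms the ring is a polynomial ring in the remaining coordinates, where the
    next form is a nonzero variable. *)
Lemma lform_regular : regular_sequence (lform c).
Proof.
split=> [i x J|].
  have JP y : (exists2 j : 'I_s, (j < i)%N & y = lform c j) <->
              exists2 j : 'I_N, (j < i)%N & y = lform T j.
    split=> [[j ji ->]|[j ji ->]]; first by exists (widen_ord le_sN j); rewrite ?lform_rows.
    exists (Ordinal (ltn_trans ji (ltn_ord i))) => //; rewrite lform_rows.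
    by congr lform; apply: val_inj.
  move=> /(ideal_lformsP T_unit JP) cx; apply/(ideal_lformsP T_unit JP).
  move: cx; rewrite lform_rows -lsubstX rmorphM /= lsubstVK // rmorphM /= /kill substX ltnn => /eqP.
  rewrite mulf_eq0 => /orP[/eqP X0|/eqP //].
  have := mcoeffXU k (widen_ord le_sN i) (widen_ord le_sN i).
  by rewrite X0 mcoeff0 eqxx => /eqP; rewrite eq_sym oner_eq0.
move=> /(ideal_lformsP T_unit lform_rowsP) /eqP.
by rewrite !rmorph1 oner_eq0.
Qed.

Lemma up_lt (l : 'I_n) : (s + l < N)%N.
Proof. by rewrite -sn ltn_add2l. Qed.

Definition up (l : 'I_n) : 'I_N := Ordinal (up_lt l).

Lemma upP (j : 'I_N) : (s <= j)%N -> exists l, j = up l.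
Proof.
move=> sj; have lt_l : (j - s < n)%N by rewrite ltn_subLR // sn.
by exists (Ordinal lt_l); apply: val_inj; rewrite /= subnKC.
Qed.

Lemma shift_up x : subst (@shiftX k N n s) (subst (fun l => 'X_(up l)) x) = x.
Proof.
apply: (mpoly_rmorph_ext (f := subst (@shiftX k N n s) \o subst (fun l => 'X_(up l)))
  (g := idfun)) x => [a|i] /=; first by rewrite !substC.
by rewrite !substX (shiftX_add k (l := i)).
Qed.

Lemma up_shift x : subst (fun l => 'X_(up l)) (subst (@shiftX k N n s) x) = kill s x.
Proof.
apply: (mpoly_rmorph_ext (f := subst (fun l => 'X_(up l)) \o subst (@shiftX k N n s))
  (g := kill s)) x => [a|i] /=; first by rewrite /kill !substC.
rewrite /kill !substX; case: ltnP => [si|/upP[l ->]]; first by rewrite shiftX_lt // rmorph0.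
by rewrite (shiftX_add k (l := l)) // substX.
Qed.

Lemma section_exists : exists phi : {lrmorphism A N -> A n},
  [/\ forall y, exists x, phi x = y,
      forall x, phi x = 0 <-> ideal_gen (fun y => exists i, y = lform c i) x
    & forall j, phi 'X_j \is 1.-homog].
Proof.
pose h i : A n := subst (@shiftX k N n s) (lform (invmx T) i).
(* [comp_mpoly] carries the linear structure that [lrmorphism] asks for. *)
pose phi : {lrmorphism A N -> A n} := comp_mpoly [tuple h i | i < N].
have phiX i : phi 'X_i = h i by rewrite /= /comp_mpoly mmapX mmap1U tnth_mktuple.
have phiE x : phi x = subst (@shiftX k N n s) (lsubst (invmx T) x).
  apply: (mpoly_rmorph_ext (f := phi) (g := subst (@shiftX k N n s) \o lsubst (invmx T))) x
    => [a|i]; last by rewrite [RHS]/= lsubstX; exact: phiX.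
  by rewrite /= comp_mpolyC lsubstC substC.
exists phi; split=> [y|x|j].
- by exists (lsubst T (subst (fun l => 'X_(up l)) y)); rewrite phiE lsubstVK // shift_up.
- rewrite (ideal_lformsP T_unit lform_rowsP) phiE -up_shift; split=> [->|x0].
    by rewrite rmorph0.
  by rewrite -[LHS]shift_up x0 rmorph0.
- rewrite phiX /h /lform rmorph_sum; apply: rpred_sum => i _.
  rewrite -mul_mpolyC rmorphM /= substC substX mul_mpolyC; apply: rpredZ.
  have [si|/upP[l ->]] := ltnP i s; first by rewrite shiftX_lt // rpred0.
  by rewrite (shiftX_add k (l := l)) // dhomogX /= mdeg1.
Qed.

Section Presentation.
Variable phi : {rmorphism A N -> A n}.
Hypotheses (phi_surj : forall y, exists x, phi x = y).
Hypothesis phi_ker : forall x, phi x = 0 <-> ideal_gen (fun y => exists i, y = lform c i) x.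

(** The change of coordinates of k[X_1, ..., X_n] whose new variables are the images of y_s,
    y_(s+1), and so on. *)
Definition section_coord : A n -> A n := phi \o subst (fun l => lform T (up l)).
HB.instance Definition _ :=
  GRing.RMorphism.copy section_coord (phi \o subst (fun l => lform T (up l))).

Lemma section_coordX l : section_coord 'X_l = phi (lform T (up l)).
Proof. by rewrite /section_coord /= substX. Qed.

Lemma phi_lform_lt (j : 'I_N) : (j < s)%N -> phi (lform T j) = 0.
Proof. by move=> js; apply/phi_ker/mem_ideal_gen/lform_rowsP; exists j. Qed.

Lemma phi_lsubst z : phi (lsubst T z) = section_coord (subst (@shiftX k N n s) z).
Proof.
apply: (mpoly_rmorph_ext (f := phi \o lsubst T)
  (g := section_coord \o subst (@shiftX k N n s))) z => [a|j] /=.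
  by rewrite /section_coord /= !substC lsubstC.
rewrite lsubstX substX; have [js|/upP[l ->]] := ltnP j s.
  by rewrite phi_lform_lt // shiftX_lt // rmorph0.
by rewrite (shiftX_add k (l := l)) // section_coordX.
Qed.

Lemma section_coord_bij : bijective section_coord.
Proof.
have subst_up z : subst (fun l => lform T (up l)) z = lsubst T (subst (fun l => 'X_(up l)) z).
  apply: (mpoly_rmorph_ext (f := subst (fun l => lform T (up l)))
    (g := lsubst T \o subst (fun l => 'X_(up l)))) z => [a|l] /=.
    by rewrite !substC lsubstC.
  by rewrite !substX lsubstX.
have ker0 z : section_coord z = 0 -> z = 0.
  rewrite /section_coord /= subst_up => /phi_ker/(ideal_lformsP T_unit lform_rowsP).
  rewrite lsubstVK // -up_shift shift_up => z0.
  by rewrite -[z]shift_up z0 rmorph0.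
have inj : injective section_coord.
  by move=> x y /eqP; rewrite -subr_eq0 -rmorphB => /eqP/ker0/eqP; rewrite subr_eq0 => /eqP.
have surj y : exists x, section_coord x == y.
  have [x <-] := phi_surj y; exists (subst (@shiftX k N n s) (lsubst (invmx T) x)).
  by rewrite -phi_lsubst lsubstK.
exists (fun y => xchoose (surj y)) => y; first by apply: inj; apply/eqP/(xchooseP (surj _)).
exact/eqP/(xchooseP (surj y)).
Qed.

End Presentation.
End LinearSection.

(** * Height of a linear section *)

Section ParametersModPrime.
Variables (k : fieldType) (N delta : nat) (le_dN : (delta <= N)%N).
Local Notation A n := {mpoly k[n]}.
Variables (J : A N -> Prop) (T : 'M[k]_N) (q : nat) (K : {pred A N}).
Hypotheses (Ji : is_ideal J) (T_unit : T \in unitmx) (JT : params le_dN J T q).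
Hypotheses (Kp : is_prime_ideal K) (JK : forall x, J x -> x \in K).
Variable w : 'I_delta -> A N.
Hypothesis w_ind : alg_indep_mod w (fun x => x \in K).

(* A nonzero element of K in k[y_0, ..., y_(delta-1)] would lengthen the chain
   of contractions of K to N - delta + 1, which [chain_length_le] forbids. *)
Lemma params_alg_indep F : param_subst le_dN T F \in K -> F = 0.
Proof.
have inclE x : lsubst T (incl le_dN x) = param_subst le_dN T x.
  apply: (mpoly_rmorph_ext (f := lsubst T \o incl le_dN) (g := param_subst le_dN T)) x
    => [a|i] /=; first by rewrite /incl /param_subst !substC lsubstC.
  by rewrite /incl /param_subst !substX lsubstX.
have [|C [Cp Cs Cl C0]] := long_chain (le_dn := le_dN) (lsubst_bij T_unit) Kp.
  move=> j _; have [p p_mon Jp] := integral_mod_ideal Ji (params_finite Ji JT) (lform T j).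
  exists p => //; apply: JK; rewrite /= lsubstX.
  by rewrite (eq_map_poly (g := param_subst le_dN T)).
move=> FK; apply/eqP; apply: contraT => F_neq0.
(* The zero ideal is put below [C 0], which contains the nonzero image of F. *)
pose C' i : {pred A N} := if i is i'.+1 then C i' else [pred x | idfun x == 0].
have : prime_chain_to K (N - delta).+1.
  exists C'; split=> // [[|i] i_lt|[|i] i_lt] /=; try by [apply: Cp | apply: Cs].
    exact: (kernel_prime idfun).
  split; last first.
    exists (param_subst le_dN T F); first by rewrite -inclE; apply: C0; rewrite /= inclE.
    rewrite inE /= -inclE; apply: contra F_neq0 => /eqP.
    rewrite -(rmorph0 (lsubst T)) => /(bij_inj (lsubst_bij T_unit)).
    by rewrite -(rmorph0 (incl le_dN)) => /incl_inj ->.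
  by move=> x; rewrite inE /= => /eqP ->; have [[-> _ _] _] := Cp 0%N isT.
move=> /(chain_length_le w_ind); lia.
Qed.

End ParametersModPrime.

Section SectionHeight.
Variables (k : fieldType) (N n s : nat) (le_sN : (s <= N)%N) (sn : (s + n)%N = N).
Variables (delta : nat) (le_dN : (delta <= N)%N).
Local Notation A n := {mpoly k[n]}.
Variables (T : 'M[k]_N) (c : 'M[k]_(s, N)).
Hypotheses (T_unit : T \in unitmx) (Tc : forall i j, T (widen_ord le_sN i) j = c i j).
Variables (J : A N -> Prop) (q : nat).
Hypotheses (Ji : is_ideal J) (JT : params le_dN J T q).
Hypothesis J_origin : forall x, J x -> x.@[fun _ => 0] = 0.
Variables (K : {pred A N}) (w : 'I_delta -> A N).
Hypotheses (Kp : is_prime_ideal K) (JK : forall x, J x -> x \in K).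
Hypothesis w_ind : alg_indep_mod w (fun x => x \in K).
Variable phi : {rmorphism A N -> A n}.
Hypotheses (phi_surj : forall y, exists x, phi x = y).
Hypothesis phi_ker : forall x, phi x = 0 <-> ideal_gen (fun y => exists i, y = lform c i) x.
Hypothesis phiC : forall a, phi a%:MP = a%:MP.
Variable J' : A n -> Prop.
Hypothesis J'P : forall y, J' y <-> exists2 x, J x & phi x = y.

Let d := (delta - s)%N.
Let le_dn : (d <= n)%N.
Proof. by rewrite /d; lia. Qed.

Let g := section_coord sn T phi.
Let lift_d : A d -> A N := subst (fun l => lform T (up sn (widen_ord le_dn l))).
HB.instance Definition _ :=
  GRing.RMorphism.copy lift_d (subst (fun l => lform T (up sn (widen_ord le_dn l)))).

Let g_incl f : g (incl le_dn f) = phi (lift_d f).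
Proof.
apply: (mpoly_rmorph_ext (f := g \o incl le_dn) (g := phi \o lift_d)) f => [a|l] /=.
  by rewrite /g /section_coord /lift_d /incl /= !substC.
by rewrite /incl /lift_d !substX /g section_coordX.
Qed.

(** If f lies in J + (y_0, ..., y_(s-1)), its action on the module generators modulo J is a matrix
    with entries in (y_0, ..., y_(s-1)). The resulting determinant is zero by [params_alg_indep],
    and setting these y_j to zero turns it into a power of f. *)
Lemma section_disjoint f : J' (g (incl le_dn f)) -> f = 0.
Proof.
move=> /J'P[x Jx]; rewrite g_incl => /eqP.
rewrite eq_sym -subr_eq0 -rmorphB => /eqP /phi_ker fx.
pose span z := exists h : 'I_s -> A N, z = \sum_j lform T (widen_ord le_sN j) * h j.
have [h hE] : span (lift_d f - x).
  apply: (ideal_gen_min (J := span) _ _ fx) => [|_ [i ->]].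
    split; first by exists (fun _ => 0); rewrite big1 // => j _; rewrite mulr0.
    move=> a _ _ [h ->] [h' ->]; exists (fun j => a * h j + h' j).
    by rewrite mulr_sumr -big_split; apply: eq_bigr => j _; rewrite mulrDr mulrCA.
  exists (fun j => (j == i)%:R); rewrite (bigD1 i) //= eqxx mulr1 big1 ?addr0.
    by rewrite (lform_rows Tc).
  by move=> j /negbTE ->; rewrite mulr0.
(* If delta <= s, then f is a constant, and evaluation at the origin shows that it is zero. *)
have [le_ds|lt_sd] := leqP delta s.
  have d0 : d = 0%N by apply/eqP; rewrite subn_eq0.
  have [a fa] : exists a, f = a%:MP by exists f@_0; apply: nvar0_mpolyC_eq.
  have [ev evE] : exists ev : {rmorphism A N -> k}, ev =1 meval (fun _ => 0).
    by exists (meval (fun _ => 0)).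
  have := congr1 ev hE; rewrite fa /lift_d substC rmorphB (evE x) (evE a%:MP) mevalC.
  rewrite J_origin // subr0 => ->.
  rewrite rmorph_sum big1 ?mpolyC0 // => j _.
  rewrite rmorphM /lform rmorph_sum big1 ?mul0r // => i _.
  by rewrite -mul_mpolyC rmorphM /= (evE 'X_i) mevalXU mulr0.
have lt_d (l : 'I_d) : (s + l < delta)%N by rewrite -ltn_subRL.
pose into : A d -> A delta := subst (fun l => 'X_(Ordinal (lt_d l))).
pose f1 := into f.
have intoE z : param_subst le_dN T (into z) = lift_d z.
  apply: (mpoly_rmorph_ext (f := param_subst le_dN T \o subst (fun l => 'X_(Ordinal (lt_d l))))
    (g := lift_d)) z => [a|l] /=; first by rewrite /param_subst /lift_d !substC.
  by rewrite /param_subst /lift_d !substX; congr lform; apply: val_inj.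
pose m := #|{: 'X_{1..N < q.+1}}|; pose e : 'I_m -> A N := @gen_mon k N q.
have [b Jb] : exists b : 'I_s -> 'I_m -> 'I_m -> A delta, forall j i,
    J (h j * e i - \sum_l param_subst le_dN T (b j i l) * e l).
  apply: (fin_all_exists (P := fun j b => forall i,
    J (h j * e i - \sum_l param_subst le_dN T (b i l) * e l))) => j.
  apply: (fin_all_exists (P := fun i b =>
    J (h j * e i - \sum_l param_subst le_dN T (b l) * e l))) => i.
  exact: (params_finite Ji JT).
pose wid_s j := widen_ord (ltnW lt_sd) j.
(* Modulo J this matrix annihilates the generators e. *)
pose M : 'M[A delta]_m := f1%:M - \matrix_(i, l) \sum_j 'X_(wid_s j) * b j i l.
have M0 : \det M = 0.
  apply: (params_alg_indep Ji T_unit JT Kp JK w_ind); apply: JK.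
  rewrite -det_map_mx; apply: (@det_in_ideal _ J m e) => //; last first.
    by have [b1 Jb1] := params_finite Ji JT 1; exists (fun i => param_subst le_dN T (b1 i)).
  move=> i; pose y j := lform T (widen_ord le_sN j).
  have -> : \sum_l map_mx (param_subst le_dN T) M i l * e l =
      x * e i + \sum_j y j * (h j * e i - \sum_l param_subst le_dN T (b j i l) * e l).
    transitivity (lift_d f * e i - \sum_l \sum_j y j * param_subst le_dN T (b j i l) * e l).
      rewrite -intoE -/f1 -sumrN (_ : _ * e i = \sum_l param_subst le_dN T (f1 *+ (i == l)) * e l).
        rewrite -big_split; apply: eq_bigr => l _; rewrite !mxE rmorphB /= mulrBl.
        congr (_ - _); rewrite rmorph_sum mulr_suml; apply: eq_bigr => j _.
        rewrite rmorphM; congr (_ * _ * _); rewrite /= /param_subst substX.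
        by congr lform; apply: val_inj.
      rewrite (bigD1 i) //= eqxx mulr1n big1 ?addr0 // => l li.
      by rewrite eq_sym (negbTE li) mulr0n rmorph0 mul0r.
    rewrite (_ : lift_d f = x + \sum_j y j * h j); last by rewrite -hE addrC subrK.
    rewrite mulrDl -addrA; congr (_ + _); rewrite exchange_big -sumrN mulr_suml -big_split.
    apply: eq_bigr => j _; rewrite mulrBr mulrA; congr (_ - _).
    by rewrite mulr_sumr; apply: eq_bigr => l _; rewrite mulrA.
  apply: is_idealD => //; first by rewrite mulrC; apply: is_idealM.
  by apply: is_ideal_sum => // j _; apply: is_idealM.
(* Setting the first s parameters to zero and renumbering the others turns M into the scalar matrix
   f. *)
have [ev evC evX] : exists2 ev : {rmorphism A delta -> A d},
    forall a, ev a%:MP = a%:MP & forall i, ev 'X_i = shiftX k d s i.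
  by exists (subst (shiftX k d s)) => a; [apply: substC | apply: substX].
have ev_into z : ev (into z) = z.
  apply: (mpoly_rmorph_ext (f := ev \o subst (fun l => 'X_(Ordinal (lt_d l))))
    (g := idfun)) z => [a|j] /=; first by rewrite substC evC.
  by rewrite substX evX (shiftX_add k (l := j)).
have evM : map_mx ev M = f%:M.
  apply/matrixP => i l; rewrite !mxE rmorphB rmorphMn ev_into.
  suff -> : ev (\sum_j 'X_(wid_s j) * b j i l) = 0 by rewrite subr0.
  by rewrite rmorph_sum big1 // => j _; rewrite rmorphM evX shiftX_lt ?mul0r ?(ltn_ord j).
have : \det (map_mx ev M) = 0 by rewrite det_map_mx M0 rmorph0.
by rewrite evM det_scalar => /eqP; rewrite expf_eq0 => /andP[_ /eqP].
Qed.

(** Applying phi to an integral equation over y_0, ..., y_(delta-1) kills the first s parameters and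
    leaves one over d coordinates, as [long_chain] requires. *)
Lemma section_chain (P : {pred A n}) : is_prime_ideal P -> (forall x, J' x -> x \in P) ->
  prime_chain_to P (n - d).
Proof.
move=> Pp J'P'.
have [|C [Cp Cs Cl _]] := long_chain (le_dn := le_dn)
  (section_coord_bij sn T_unit Tc phi_surj phi_ker) Pp; last by exists C.
move=> j _; rewrite /= section_coordX.
have [p p_mon Jp] := integral_mod_ideal Ji (params_finite Ji JT) (lform T (up sn j)).
pose ev : {rmorphism A delta -> A d} := subst (@shiftX k delta d s).
exists (map_poly ev p); first exact: monic_map.
apply: J'P'; apply/J'P; exists (map_poly (param_subst le_dN T) p).[lform T (up sn j)] => //.
rewrite -horner_map -!map_poly_comp; congr (_.[_]); apply: eq_map_poly.
apply: mpoly_rmorph_ext => [a|i] /=.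
  by rewrite /ev /param_subst /section_coord /incl /= !substC.
rewrite /param_subst /ev !substX; have [lt_is|le_si] := ltnP i s.
  by rewrite shiftX_lt // !rmorph0 (phi_lform_lt Tc).
have lt_l : (i - s < d)%N by rewrite /d; move: (ltn_ord i); lia.
rewrite (shiftX_add k (l := Ordinal lt_l)) ?subnKC // /incl substX section_coordX.
by congr (phi (lform T _)); apply: val_inj; rewrite /= subnKC.
Qed.

Lemma section_height : ideal_height J' (n - d).
Proof.
have J'i : is_ideal J'.
  split; first by apply/J'P; exists 0; [case: Ji | rewrite rmorph0].
  move=> a x y /J'P[x1 Jx <-] /J'P[y1 Jy <-]; have [a1 <-] := phi_surj a.
  by apply/J'P; exists (a1 * x1 + y1); [apply: Ji.2 | rewrite rmorphD rmorphM].
have g_inj := bij_inj (section_coord_bij sn T_unit Tc phi_surj phi_ker).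
split; last first.
  by move=> P h Pp J'P' [_ h_max]; apply/h_max/section_chain.
(* A prime over J' that avoids all nonzero polynomials in the first d coordinates keeps these
   independent, so [chain_length_le] bounds its height. *)
have [|||P [Pp J'P' nP]] := @prime_avoiding _ J'
    (fun x => exists2 f, f != 0 & x = g (incl le_dn f)) J'i.
- by exists 1; rewrite ?oner_neq0 // /g !rmorph1.
- move=> _ _ [f f0 ->] [f' f'0 ->]; exists (f * f'); first exact: mulf_neq0.
  by rewrite /g !rmorphM.
- by move=> x J'x [f /eqP f0 xE]; apply: f0; apply: section_disjoint; rewrite -/g -xE.
exists P; split=> //; split; first exact: section_chain.
have wE F : subst (fun l => g 'X_(widen_ord le_dn l)) F = g (incl le_dn F).
  apply: (mpoly_rmorph_ext (g := g \o incl le_dn)) F => [a|i] /=.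
    by rewrite /g /section_coord /incl /= !substC phiC.
  by rewrite /incl !substX.
move=> l Pl; rewrite -(leq_add2l d) subnKC //.
apply: (chain_length_le (w := fun l => g 'X_(widen_ord le_dn l))) Pl => F.
by rewrite wE => FP; apply/eqP; apply: contraT => F0; exfalso; apply: (nP _ FP); exists F.
Qed.

End SectionHeight.

(** * Minors of a general linear matrix *)

Section GeneralSection.
Variables (k : fieldType) (p q r s : nat).
Hypothesis (k_inf : infinite_type k).
Local Notation A n := {mpoly k[n]}.
Local Notation N := (p * q)%N.
Local Notation Z := (\matrix_(i < p, j < q) 'X_(mxvec_index i j) : 'M[A N]_(p, q)).
Local Notation minorsZ := (@minors_ideal (A N) p q r.+1 Z).
Hypothesis le_sN : (s <= N)%N.

(** The first s rows of T0 are replaced by indeterminates, the coefficients of the L_i, and the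
    other rows are kept. F is the polynomial of [params_open] times the determinant; it is nonzero
    because it does not vanish at T0. *)
Lemma general_params : exists2 F : A (s * N), F != 0 &
  forall c : 'M[k]_(s, N), F.@[fun i => mxvec c 0 i] != 0 ->
  exists T : 'M[k]_N, [/\ T \in unitmx, forall i j, T (widen_ord le_sN i) j = c i j
    & exists e, params (@rank_dim_le p q r) minorsZ T e].
Proof.
have [T0 T0_unit [e T0_params]] := minorsZ_params p q r k_inf.
pose TT : 'M[A (s * N)]_N := \matrix_(j, i)
  (if insub (val j) is Some l then 'X_(mxvec_index (l : 'I_s) i) else (T0 j i)%:MP).
pose c0 (x : 'I_(s * N)) := T0 (widen_ord le_sN (cell_of x).1) (cell_of x).2.
have TT0 : map_mx (meval c0) TT = T0.
  apply/matrixP => j i; rewrite !mxE; case: insubP => [l _ lj|_] /=; last by rewrite mevalC.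
  by rewrite mevalXU /c0 mxvec_indexK /=; congr (T0 _ _); apply: val_inj.
have [|F F0 FP] :=
    @params_open _ _ _ (@rank_dim_le p q r) minorsZ _ TT c0 e (@minorsZ_ideal k p q r).
  by rewrite TT0.
exists (F * \det TT).
  have : (F * \det TT).@[c0] != 0.
    rewrite mevalM mulf_neq0 // -det_map_mx TT0 -unitfE -unitmxE //.
  by apply: contra_neq => ->; rewrite meval0.
move=> c; rewrite mevalM mulf_eq0 negb_or => /andP[Fc]; rewrite -det_map_mx => TTc.
exists (map_mx (meval (fun i => mxvec c 0 i)) TT); split.
- by rewrite unitmxE unitfE.
- move=> i j; rewrite !mxE insubT /= => [|i_lt]; first exact: ltn_ord.
  by rewrite mevalXU mxvecE; congr (c _ _); apply: val_inj.
- by exists e; apply: FP.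
Qed.

Lemma minorsZ_map n (phi : {rmorphism A N -> A n}) :
  (forall y, exists x, phi x = y) ->
  forall y, minors_ideal r.+1 (map_mx phi Z) y <-> exists2 x, minorsZ x & phi x = y.
Proof.
move=> phi_surj y.
have minor_map f g : \det (mxsub f g (map_mx phi Z)) = phi (\det (mxsub f g Z)) :> A n.
  by rewrite -det_map_mx; congr (\det _); apply/matrixP => i j; rewrite !mxE.
split=> [|[x Zx <-]].
  apply: (ideal_gen_min (J := fun y => exists2 x, minorsZ x & phi x = y)).
    split; first by exists 0; [case: (minorsZ_ideal k p q r) | rewrite rmorph0].
    move=> a _ _ [x Zx <-] [z Zz <-]; have [b <-] := phi_surj a.
    exists (b * x + z); last by rewrite rmorphD rmorphM.
    exact: (minorsZ_ideal k p q r).2.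
  move=> _ [f [g [f_incr g_incr ->]]]; exists (\det (mxsub f g Z)); last by rewrite -minor_map.
  by apply: mem_ideal_gen; exists f, g.
apply: (ideal_gen_min (J := fun x => minors_ideal r.+1 (map_mx phi Z) (phi x)) _ _ Zx).
  have [I0 ID] := ideal_gen_is_ideal (is_minor r.+1 (map_mx phi Z)).
  split; first by rewrite rmorph0.
  by move=> a u v Iu Iv; rewrite rmorphD rmorphM; apply: ID.
move=> _ [f [g [f_incr g_incr ->]]]; rewrite -minor_map.
by apply: mem_ideal_gen; exists f, g.
Qed.

Lemma minorsZ_origin x : minorsZ x -> x.@[fun _ => 0] = 0.
Proof.
have [ev evE] : exists ev : {rmorphism A N -> k}, ev =1 meval (fun _ => 0).
  by exists (meval (fun _ => 0)).
move=> Zx; rewrite -evE.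
apply: (ideal_gen_min (J := fun x => ev x = 0) _ _ Zx).
  split; first by rewrite rmorph0.
  by move=> a u v u0 v0; rewrite rmorphD rmorphM u0 v0 mulr0 addr0.
move=> _ [f [g [_ _ ->]]]; rewrite -det_map_mx (_ : map_mx _ _ = 0) ?det0 //.
by apply/matrixP => i j; rewrite !mxE evE mevalXU.
Qed.

End GeneralSection.

Unset Implicit Arguments.
Local Close Scope ring_scope.

Theorem theorem2p2 (k : fieldType) (n m : nat) :
  infinite_type k -> 3 <= n -> 2 <= m -> n <= m * m.-1 ->
  @for_general_linear_matrix k n m (fun L =>
    forall t : nat, 1 <= t <= m.-1 ->
      ideal_height (minors_ideal t L) (minn n ((m - t + 1) * (m - t)))).
Proof.
move=> k_inf n3 m2 le_nN.
pose s := m * m.-1 - n; have le_sN : s <= m * m.-1 by apply: leq_subr.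
have sn : s + n = m * m.-1 by rewrite subnK.
pose spec (r : 'I_m) (F : {mpoly k[s * (m * m.-1)]}) := F != 0%R /\
    forall c : 'M[k]_(s, m * m.-1), meval (fun i => mxvec c ord0 i) F != 0%R ->
    exists T : 'M[k]_(m * m.-1), [/\ T \in unitmx,
      forall i j, T (widen_ord le_sN i) j = c i j
      & exists e, params (@rank_dim_le m m.-1 r) (minors_ideal r.+1 (generic_matrix k m)) T e].
have [F FP] : exists F, forall r, spec r (F r).
  apply: (fin_all_exists (P := spec)) => r.
  by have [F F0 FP] := general_params (q := m.-1) r k_inf le_sN; exists F.
(* The product of these polynomials defines one open set that serves all t at once. *)
pose G := (\prod_r F r)%R.
exists (fun c => meval (fun i => mxvec c ord0 i) G != 0%R); split.
- exists (fun f => f = G) => c; split=> [Gc|[f -> //]]; by exists G.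
- have [v Gv] : exists v, meval v G != 0%R.
    by apply: (mpoly_neq0_point k_inf); apply/prodf_neq0 => r _; case: (FP r).
  exists (vec_mx (\row_i v i)%R); congr (_ != _): Gv.
  by apply: meval_eq => i; rewrite vec_mxK mxE.
move=> c; rewrite /G rmorph_prod => /prodf_neq0 Gc.
have good (r : 'I_m) := (FP r).2 c (Gc r isT).
have m_gt0 : 0 < m by apply: ltnW.
(* Any invertible completion of c settles regularity and the presentation; r = 0 supplies one. *)
have [T [T_unit Tc _]] := good (Ordinal m_gt0).
split; first exact: (lform_regular T_unit Tc).
  exact: (section_exists sn T_unit Tc).
move=> phi [phi_surj phi_ker _] t /andP[t_gt0 t_le].
case: t t_gt0 t_le => // r _ r_le.
have lt_rm : r < m by lia.
have [T1 [T1_unit T1c [e T1_params]]] := good (Ordinal lt_rm).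
have [|K [Kp JK [w w_ind]]] := @minorsZ_prime k m m.-1 r k_inf (ltnW lt_rm); first by lia.
have phiC a : phi (mpolyC _ a) = mpolyC _ a.
  by rewrite -!alg_mpolyC linearZ rmorph1.
have := section_height sn T1_unit T1c (minorsZ_ideal k m m.-1 r) T1_params
  (@minorsZ_origin k m m.-1 r) Kp JK w_ind phi_surj phi_ker phiC
  (minorsZ_map r phi_surj).
congr (ideal_height _ _); rewrite /rank_dim /s /=.
have -> : (m - r.+1 + 1) * (m - r.+1) = (m - r) * (m.-1 - r) by congr muln; lia.
(* Here a - b is delta and a - n is s, so the left side is n - d. *)
have arith a b : n <= a -> b <= a -> n - (a - b - (a - n)) = minn n b by lia.
by apply: arith => //; apply: leq_mul; apply: leq_subr.
Qed.
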